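(* Let $K$ be a field, let $m>h>0$ be integers such that $m$ is not divisible by the characteristic of $K$, and let $F_1(X,Y),\dots,F_h(X,Y)\in K[X,Y]$ be pairwise coprime homogeneous linear polynomials. Let $R$ be the local ring of the point $(0,0,0)$ on the irreducible surface $$Z^m-F_1(X,Y)\cdots F_h(X,Y)=0,$$ and let $M$ be the maximal ideal of $R$. Then $R$ is a normal local domain and $M$ is a normal ideal in $R$, i.e., for every positive integer $p$ the ideal $M^p$ is a complete ideal in $R$. Moreover, if $F_0(X,Y)\in K[X,Y]$ is a homogeneous linear polynomial which is coprime to $F_1(X,Y),\dots,F_h(X,Y)$, then for every positive integer $p$ the ideal of $R$ generated by (the images of) $F_0(X,Y)^p$ and $Z^p$ is a reduction of $M^p$.
   Context: The local ring $R$ of the origin on the surface $G=0$, with $G=Z^m-F_1\cdots F_h$, is the localization of $K[X,Y,Z]/(G)$ at the maximal ideal generated by the images of $X,Y,Z$. A domain is normal if it is integrally closed in its quotient field. For an ideal $J$ in a domain $A$ with quotient field $L$, the completion of $J$ is $\overline J=\bigcap_V JV$, where $V$ ranges over all valuation rings with quotient field $L$ containing $A$; for $A$ normal, $J$ is complete if $\overline J=J$. An ideal $J\subset I$ is a reduction of $I$ if $JI^n=I^{n+1}$ for some nonnegative integer $n$. *)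

(* Defs.v *)
From HB Require Import structures.
From mathcomp Require Import all_boot all_order all_algebra.
From mathcomp Require Import boolp classical_sets.
From mathcomp Require Import mpoly.

Set Implicit Arguments.
Unset Strict Implicit.
Unset Printing Implicit Defensive.

Import GRing.Theory.

Local Open Scope classical_set_scope.
Local Open Scope ring_scope.

(* Finite sums of products c * s with c in C and s in S.  With C the whole ring
   this is the ideal generated by S; with C a subring of a field and S the image
   of an ideal J, it is the extension JC. *)
Definition lin_span (A : comNzRingType) (C S : set A) : set A :=
  [set x | exists (n : nat) (c s : 'I_n -> A),
     [/\ forall i, C (c i), forall i, S (s i) & x = \sum_(i < n) c i * s i]].

Definition ideal_gen (A : comNzRingType) (S : set A) : set A := lin_span setT S.

Definition idealM (A : comNzRingType) (I J : set A) : set A :=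
  ideal_gen [set x * y | x in I & y in J].

Definition idealX (A : comNzRingType) (I : set A) (n : nat) : set A :=
  iter n (idealM I) setT.

(* [idealr_closed] is the library's notion of a proper ideal. *)
Definition maximal_ideal (A : comNzRingType) (M : set A) : Prop :=
  idealr_closed (mem M) /\
  (forall J : set A, idealr_closed (mem J) -> M `<=` J -> J = M).

Definition local_ring (A : comNzRingType) : Prop :=
  exists! M : set A, maximal_ideal M.

Definition reduction (A : comNzRingType) (J I : set A) : Prop :=
  J `<=` I /\ exists n : nat, idealM J (idealX I n) = idealX I n.+1.

(* q presents B as the quotient of A by the ideal I. *)
Definition is_quotient (A B : comNzRingType) (q : {rmorphism A -> B})
    (I : set A) : Prop :=
  (forall b : B, exists a : A, q a = b) /\ (forall a : A, q a = 0 <-> I a).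

(* f presents R as the localization of B at the prime ideal P, that is, as the
   ring of fractions of B with denominators outside P. *)
Definition is_localization_at (B : comNzRingType) (R : comUnitRingType)
    (f : {rmorphism B -> R}) (P : set B) : Prop :=
  [/\ forall s : B, ~ P s -> f s \is a GRing.unit,
      forall r : R, exists b s : B, ~ P s /\ r = f b / f s
    & forall b : B, f b = 0 <-> exists s : B, ~ P s /\ s * b = 0].

Definition is_quotient_field (A : comNzRingType) (L : fieldType)
    (iota : {rmorphism A -> L}) : Prop :=
  injective iota /\
  (forall x : L, exists a b : A, b != 0 /\ x = iota a / iota b).

Definition normal_domain (A : comNzRingType) : Prop :=
  GRing.integral_domain_axiom A /\
  (forall (L : fieldType) (iota : {rmorphism A -> L}), is_quotient_field iota ->
     forall x : L, integralOver iota x -> exists a : A, x = iota a).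

(* V is a valuation ring with quotient field L. *)
Definition valuation_ring (L : fieldType) (V : set L) : Prop :=
  GRing.subring_closed (mem V) /\ (forall x : L, x != 0 -> V x \/ V x^-1).

Definition completion (A : comNzRingType) (L : fieldType)
    (iota : {rmorphism A -> L}) (J : set A) : set L :=
  [set x | forall V : set L, valuation_ring V -> range iota `<=` V ->
     lin_span V (iota @` J) x].

(* Quotient fields being unique up to isomorphism, the quantification over
   (L, iota) does not depend on a choice of the quotient field. *)
Definition complete_ideal (A : comNzRingType) (J : set A) : Prop :=
  forall (L : fieldType) (iota : {rmorphism A -> L}), is_quotient_field iota ->
    completion iota J = iota @` J.

Definition normal_ideal (A : comNzRingType) (I : set A) : Prop :=
  forall p : nat, (0 < p)%N -> complete_ideal (idealX I p).

(* The zero polynomial is 1.-homog, hence the condition F != 0. *)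
Definition linear_form (K : fieldType) (n : nat) (F : {mpoly K[n]}) : Prop :=
  F != 0 /\ F \is 1.-homog.

Definition irreducible_elt (A : idomainType) (x : A) : Prop :=
  [/\ x != 0, x \isn't a GRing.unit
    & forall a b : A, x = a * b -> a \is a GRing.unit \/ b \is a GRing.unit].

Definition coprime_elts (A : idomainType) (x y : A) : Prop :=
  forall d : A, (exists a, x = a * d) -> (exists b, y = b * d) ->
    d \is a GRing.unit.

(* [mwiden] is the inclusion of K[X,Y] in K[X,Y,Z]; the last variable is Z. *)
Definition surface_poly (K : fieldType) (m h : nat)
    (F : 'I_h -> {mpoly K[2]}) : {mpoly K[3]} :=
  'X_ord_max ^+ m - \prod_(i < h) mwiden (F i).

(* Main.v *)
Require Import Defs.
From HB Require Import structures.
From mathcomp Require Import all_boot all_order all_algebra.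
From mathcomp Require Import cyclic vector fieldext separable cyclotomic.
From mathcomp Require Import boolp classical_sets.
From mathcomp Require Import mpoly ring zify.

Set Implicit Arguments.
Unset Strict Implicit.
Unset Printing Implicit Defensive.

Import GRing.Theory.

Local Open Scope classical_set_scope.
Local Open Scope ring_scope.

(** Let [f] be the product of the linear forms and [z] the image of [Z].

    The surface is irreducible by Eisenstein's criterion at one of the forms
    ([eisenstein_prime]).

    Normality. The ring [K[X,Y]] is integrally closed; this is proved in the form
    of complete integral closedness, which passes easily from a domain to its
    polynomial ring ([poly_completely_closed]). An element that is integral over
    [K[X,Y]] in the field generated by [z] is a polynomial in [z] over the field
    of fractions. Since [m] is invertible, averaging its conjugates over the
    [m]-th roots of unity shows that each term of this polynomial is integral,
    and since [f] is squarefree the coefficients have no denominators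
    ([integral_kummer]). Localization preserves this.

    Completeness of the powers of the maximal ideal [M]. An element of the
    completion of an ideal is integral over the ideal: were it not, Zorn's lemma
    would provide a valuation ring that excludes it ([completion_integral]). An
    element integral over a power of [M] lies in the local ring, by normality.
    Because [h < m], the tangent cone at the origin is given by [f = 0], so that
    the associated graded ring of [M] is [K[X,Y,Z] / (f)], which is reduced: the
    [n]-th power of an element has [n] times its order ([reduced_cone]), and
    therefore an element integral over the [p]-th power of [M] has order at least
    [p].

    Reductions. Modulo [F0] each of the other forms is a nonzero multiple of one
    and the same variable [w], so [Z ^+ m = f] shows that [w ^+ h] lies in
    [(F0, Z) M^(h-1)]. As [M] is generated by [F0], [Z] and [w], an element of a
    high power of [M] is a combination of products [F0^a Z^b] with [a + b] large,
    one exponent of which is then at least [p] ([reduction_powers]). *)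

(** * Ideals and their powers *)

Definition is_ideal (A : comNzRingType) (I : set A) : Prop :=
  [/\ I 0, forall x y, I x -> I y -> I (x + y) & forall a x, I x -> I (a * x)].

Section Ideals.
Variable A : comNzRingType.
Implicit Types (I J S : set A).

Lemma ideal_sum I (T : Type) (r : seq T) (P : pred T) (F : T -> A) :
  is_ideal I -> (forall i, P i -> I (F i)) -> I (\sum_(i <- r | P i) F i).
Proof. by case=> I0 ID _ IF; apply: big_ind. Qed.

Lemma ideal_opp I x : is_ideal I -> I x -> I (- x).
Proof. by case=> _ _ IM Ix; rewrite -mulN1r; apply: IM. Qed.

Lemma ideal_mulr I x a : is_ideal I -> I x -> I (x * a).
Proof. by case=> _ _ IM Ix; rewrite mulrC; apply: IM. Qed.

Lemma lin_spanD C S x y :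
  lin_span C S x -> lin_span C S y -> lin_span C S (x + y).
Proof.
move=> [n [c [s [Cc Ss ->]]]] [k [d [t [Cd St ->]]]].
exists (n + k)%N.
exists (fun i => match split i with inl j => c j | inr j => d j end).
exists (fun i => match split i with inl j => s j | inr j => t j end).
split=> [i|i|]; try by case: (split i).
rewrite big_split_ord /=; congr (_ + _); apply: eq_bigr => i _.
  by have := unsplitK (inl i : 'I_n + 'I_k); rewrite /unsplit /= => ->.
by have := unsplitK (inr i : 'I_n + 'I_k); rewrite /unsplit /= => ->.
Qed.

Lemma lin_span0 C S : lin_span C S 0.
Proof.
exists 0%N, (fun _ => 0), (fun _ => 0); split=> [[]//|[]//|].
by rewrite big_ord0.
Qed.

Lemma lin_span_term C S c s : C c -> S s -> lin_span C S (c * s).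
Proof.
move=> Cc Ss; exists 1%N, (fun _ => c), (fun _ => s); split=> //.
by rewrite big_ord1.
Qed.

Lemma ideal_gen_ideal S : is_ideal (ideal_gen S).
Proof.
split; first exact: lin_span0.
  by move=> x y; apply: lin_spanD.
move=> a x [n [c [s [_ Ss ->]]]].
exists n, (fun i => a * c i), s; split=> //.
by rewrite big_distrr /=; apply: eq_bigr => i _; rewrite mulrA.
Qed.

Lemma sub_ideal_gen S : S `<=` ideal_gen S.
Proof. by move=> s Ss; rewrite -[s]mul1r; apply: lin_span_term. Qed.

Lemma ideal_gen_min S I : is_ideal I -> S `<=` I -> ideal_gen S `<=` I.
Proof.
move=> idI SI _ [n [c [s [_ Ss ->]]]]; apply: ideal_sum => // i _.
by case: idI => _ _; apply; apply: SI.
Qed.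

Lemma idealM_min I J K' : is_ideal K' ->
  (forall x y, I x -> J y -> K' (x * y)) -> idealM I J `<=` K'.
Proof.
by move=> idK IJ; apply: ideal_gen_min => // _ [x Ix [y Jy <-]]; apply: IJ.
Qed.

Lemma idealM_mul I J x y : I x -> J y -> idealM I J (x * y).
Proof. by move=> Ix Jy; apply: sub_ideal_gen; exists x => //; exists y. Qed.

Lemma idealX_ideal I n : is_ideal (idealX I n).
Proof. by case: n => [|n]; [split | apply: ideal_gen_ideal]. Qed.

Lemma idealX_mul I a b x y :
  idealX I a x -> idealX I b y -> idealX I (a + b) (x * y).
Proof.
elim: a x y => [|a IH] x y.
  by move=> _ Iy; case: (idealX_ideal I b) => _ _; apply.
move=> Ix Iy; have [I0 ID IM] := idealX_ideal I (a.+1 + b).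
move: x Ix; apply: idealM_min.
  split=> [|u v Iu Iv|c u Iu]; first by rewrite mul0r.
    by rewrite mulrDl; apply: ID.
  by rewrite -mulrA; apply: IM.
by move=> u v Iu Iv; rewrite -mulrA; apply: idealM_mul => //; apply: IH.
Qed.

Lemma idealX_le I a b : (a <= b)%N -> idealX I b `<=` idealX I a.
Proof.
move=> ab x; rewrite -(subnKC ab); move: (b - a)%N => c {ab}.
elim: a x => [|a IH] x //; apply: idealM_min; first exact: idealX_ideal.
by move=> u v Iu /IH Iv; apply: idealM_mul.
Qed.

Lemma idealX1 I : is_ideal I -> idealX I 1 = I.
Proof.
move=> idI; apply/seteqP; split=> x.
  by apply: idealM_min => // u v Iu _; apply: ideal_mulr.
by move=> Ix; rewrite -[x]mulr1; apply: idealM_mul.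
Qed.

Lemma idealX_exp I n x : I x -> idealX I n (x ^+ n).
Proof.
by move=> Ix; elim: n => [|n IH] //; rewrite exprS; apply: idealM_mul.
Qed.

Lemma idealX_add I a b : idealX I (a + b) = idealM (idealX I a) (idealX I b).
Proof.
apply/seteqP; split=> x; last first.
  by apply: idealM_min; [apply: idealX_ideal | move=> u v; apply: idealX_mul].
elim: a x => [|a IH] x.
  by move=> Ix; rewrite -[x]mul1r; apply: idealM_mul.
apply: idealM_min; first exact: ideal_gen_ideal.
move=> u v Iu /(IH v); move: v; have [J0 JD JM] := ideal_gen_ideal
  [set x * y | x in idealX I a.+1 & y in idealX I b].
apply: (idealM_min (K' := fun v => idealM (idealX I a.+1) (idealX I b) (u * v))).
  split=> [|v1 v2 Iv1 Iv2|c v1 Iv1]; first by rewrite mulr0.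
    by rewrite mulrDr; apply: JD.
  by rewrite mulrCA; apply: JM.
by move=> v1 v2 Iv1 Iv2; rewrite mulrA; apply: idealM_mul => //; apply: idealM_mul.
Qed.

Lemma idealX_idealX I p n : idealX (idealX I p) n = idealX I (p * n).
Proof.
elim: n => [|n IH]; first by rewrite muln0.
by rewrite mulnS idealX_add -IH.
Qed.

End Ideals.

(** * Reductions of ideals with three generators *)

(** By [wk] the ideal of [x] and [y] is a reduction of [M]; the powers
    [x ^+ p] and [y ^+ p] need some more room. *)
Section Reduction.
Variables (A : comNzRingType) (M : set A) (x y w : A) (k : nat).
Hypotheses (idM : is_ideal M) (Mx : M x) (My : M y) (Mw : M w).
Hypothesis genM : forall r, M r -> exists a b c, r = a * x + b * y + c * w.
Hypothesis wk : exists u v,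
  [/\ idealX M k u, idealX M k v & w ^+ k.+1 = x * u + y * v].

(** Modulo the ideal of [x] and [y] only the powers of [w] survive. *)
Lemma idealX_split n r : idealX M n.+1 r -> exists u v c,
  [/\ idealX M n u, idealX M n v & r = x * u + y * v + c * w ^+ n.+1].
Proof.
elim: n r => [|n IH] r.
  rewrite (idealX1 idM) => /genM [a [b [c ->]]]; exists a, b, c; split=> //.
  by rewrite expr1 ![_ * x]mulrC ![_ * y]mulrC.
have [I0 ID IM] := idealX_ideal M n.+1.
apply: (idealM_min (K' := fun r => exists u v c,
  [/\ idealX M n.+1 u, idealX M n.+1 v & r = x * u + y * v + c * w ^+ n.+2])).
  split.
  - by exists 0, 0, 0; rewrite !mulr0 mul0r !addr0.
  - move=> _ _ [u1 [v1 [c1 [Iu1 Iv1 ->]]]] [u2 [v2 [c2 [Iu2 Iv2 ->]]]].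
    exists (u1 + u2), (v1 + v2), (c1 + c2); split; try exact: ID.
    by ring.
  - move=> a _ [u [v [c [Iu Iv ->]]]]; exists (a * u), (a * v), (a * c).
    by split; try exact: IM; ring.
move=> a b Ma /IH [u [v [c [Iu Iv ->]]]].
have [a1 [a2 [a3 ea]]] := genM Ma.
have Iw := idealX_exp n.+1 Mw.
exists (a * u + a1 * c * w ^+ n.+1), (a * v + a2 * c * w ^+ n.+1), (a3 * c).
split; first by apply: ID; [apply: idealM_mul | apply: IM].
  by apply: ID; [apply: idealM_mul | apply: IM].
by rewrite [_ ^+ n.+2]exprS mulrDr {2}ea; ring.
Qed.

Lemma idealX_two n r : (k <= n)%N -> idealX M n.+1 r ->
  exists u v, [/\ idealX M n u, idealX M n v & r = x * u + y * v].
Proof.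
move=> kn /idealX_split [u [v [c [Iu Iv ->]]]].
have [u' [v' [Iu' Iv' ew]]] := wk.
have [_ ID IM] := idealX_ideal M n.
have Iw := idealX_exp (n - k) Mw.
exists (u + c * (w ^+ (n - k) * u')), (v + c * (w ^+ (n - k) * v')).
split; try by apply: ID => //; apply: IM; rewrite -(subnK kn) addnK;
  apply: idealX_mul.
by rewrite -(subnK kn) -addnS exprD ew addnK; ring.
Qed.

(** Once the exponent exceeds [k] there is room to push every element of a
    power of [M] into the ideal of [x] and [y] again, until [x ^+ p] or
    [y ^+ p] splits off. *)
Lemma idealX_push p l a b n r : (p + p <= a + b + l)%N -> (k + l <= n)%N ->
  idealX M n r -> exists u v,
  [/\ idealX M (a + b + n - p) u, idealX M (a + b + n - p) v &
      x ^+ a * y ^+ b * r = x ^+ p * u + y ^+ p * v].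
Proof.
elim: l a b n r => [|l IH] a b n r pl kn Mr.
  have {}pl : (p <= a)%N || (p <= b)%N by lia.
  have [J0 _ _] := idealX_ideal M (a + b + n - p).
  have Ix := idealX_exp _ Mx; have Iy := idealX_exp _ My.
  case/orP: pl => [pa|pb].
    exists (x ^+ (a - p) * y ^+ b * r), 0; split=> //.
      have -> : (a + b + n - p = (a - p) + b + n)%N by lia.
      by apply: idealX_mul => //; apply: idealX_mul.
    by rewrite -{1}(subnKC pa) exprD; ring.
  exists 0, (x ^+ a * y ^+ (b - p) * r); split=> //.
    have -> : (a + b + n - p = a + (b - p) + n)%N by lia.
    by apply: idealX_mul => //; apply: idealX_mul.
  by rewrite -{1}(subnKC pb) exprD; ring.
case: n kn Mr => [|n]; first by rewrite addnS.
rewrite addnS ltnS => kn Mr.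
have kn' : (k <= n)%N by apply: leq_trans kn; apply: leq_addr.
have [u [v [Iu Iv ->]]] := idealX_two kn' Mr.
have [|u1 [v1 [Iu1 Iv1 e1]]] := IH a.+1 b n u _ kn Iu; first by lia.
have [|u2 [v2 [Iu2 Iv2 e2]]] := IH a b.+1 n v _ kn Iv; first by lia.
have [_ ID _] := idealX_ideal M (a + b + n.+1 - p).
exists (u1 + u2), (v1 + v2); split.
- by apply: ID; [move: Iu1 | move: Iu2]; rewrite ?addSn ?addnS ?addSn.
- by apply: ID; [move: Iv1 | move: Iv2]; rewrite ?addSn ?addnS ?addSn.
transitivity (x ^+ a.+1 * y ^+ b * u + x ^+ a * y ^+ b.+1 * v).
  by rewrite !exprS; ring.
by rewrite e1 e2; ring.
Qed.

Lemma reduction_powers p : (0 < p)%N ->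
  reduction (ideal_gen [set x ^+ p; y ^+ p]) (idealX M p).
Proof.
move=> p_gt0; have Ix := idealX_exp p Mx; have Iy := idealX_exp p My.
have JI : ideal_gen [set x ^+ p; y ^+ p] `<=` idealX M p.
  apply: ideal_gen_min; first exact: idealX_ideal.
  by move=> _ [->|->].
split=> //; exists (k + 2)%N; apply/seteqP; split=> r.
  apply: idealM_min; first exact: idealX_ideal.
  by move=> a b /JI Ia Ib; apply: idealM_mul.
rewrite !idealX_idealX => Mr.
have [||u [v [Iu Iv]]] := @idealX_push p (p + p) 0 0 _ r _ _ Mr; [lia|nia|].
have e : (0 + 0 + p * (k + 2).+1 - p = p * (k + 2))%N by lia.
rewrite e in Iu Iv; rewrite !mul1r => ->.
have [_ JD _] := ideal_gen_ideal [set x * y | x in ideal_gen [set x ^+ p; y ^+ p]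
  & y in idealX M (p * (k + 2))].
by apply: JD; apply: idealM_mul => //; apply: sub_ideal_gen; [left|right].
Qed.

End Reduction.

(** * Valuation rings and integral dependence on ideals *)

Section Valuations.
Variable L : fieldType.
Implicit Types (S N : set L).

Definition is_subring S : Prop :=
  [/\ S 1, forall x y, S x -> S y -> S (x - y)
    & forall x y, S x -> S y -> S (x * y)].

Lemma is_subringP S : is_subring S <-> GRing.subring_closed (mem S).
Proof.
split=> [[S1 SB SM]|[S1 SB SM]]; split.
- exact: mem_set.
- by move=> x y /set_mem Sx /set_mem Sy; apply: mem_set; apply: SB.
- by move=> x y /set_mem Sx /set_mem Sy; apply: mem_set; apply: SM.
- exact: set_mem S1.
- by move=> x y /mem_set Sx /mem_set Sy; apply: set_mem; apply: SB.
- by move=> x y /mem_set Sx /mem_set Sy; apply: set_mem; apply: SM.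
Qed.

Lemma subring0 S : is_subring S -> S 0.
Proof. by case=> S1 SB _; rewrite -(subrr 1); apply: SB. Qed.

Lemma subringD S x y : is_subring S -> S x -> S y -> S (x + y).
Proof.
move=> rS Sx Sy; have S0 := subring0 rS; case: rS => _ SB _.
by rewrite -[y]opprK; apply: (SB) => //; rewrite -[- y]sub0r; apply: SB.
Qed.

Lemma subring_sum S (T : Type) (r : seq T) (P : pred T) (F : T -> L) :
  is_subring S -> (forall i, P i -> S (F i)) -> S (\sum_(i <- r | P i) F i).
Proof.
move=> rS SF; apply: (big_ind S) => //; first exact: subring0.
by move=> x y; apply: subringD.
Qed.

Lemma lin_spanM S N a x :
  is_subring S -> S a -> lin_span S N x -> lin_span S N (a * x).
Proof.
case=> _ _ SM Sa [n [c [s [Sc Ns ->]]]].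
exists n, (fun i => a * c i), s; split=> // [i|]; first exact: SM.
by rewrite big_distrr /=; apply: eq_bigr => i _; rewrite mulrA.
Qed.

Lemma lin_span_sub S N : is_subring S -> N `<=` S -> lin_span S N `<=` S.
Proof.
move=> rS NS _ [n [c [s [Sc Ns ->]]]]; apply: subring_sum => // i _.
by case: rS => _ _; apply => //; apply: NS.
Qed.

Lemma lin_span_sum S N (T : Type) (r : seq T) (P : pred T) (F : T -> L) :
  (forall i, P i -> lin_span S N (F i)) ->
  lin_span S N (\sum_(i <- r | P i) F i).
Proof.
move=> NF; apply: (big_ind (lin_span S N)) => //; first exact: lin_span0.
by move=> x y; apply: lin_spanD.
Qed.

Definition adjoin S (t : L) : set L :=
  [set x | exists2 P : {poly L}, (forall i, S P`_i) & x = P.[t]].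

Lemma adjoin_subring S t : is_subring S -> is_subring (adjoin S t).
Proof.
move=> rS; have S0 := subring0 rS; case: (rS) => S1 SB SM; split.
- exists 1; last by rewrite hornerC.
  by move=> i; rewrite coef1; case: (i == 0)%N.
- move=> _ _ [P SP ->] [Q SQ ->]; exists (P - Q); last by rewrite hornerD hornerN.
  by move=> i; rewrite coefB; apply: SB.
- move=> _ _ [P SP ->] [Q SQ ->]; exists (P * Q); last by rewrite hornerM.
  by move=> i; rewrite coefM; apply: subring_sum => // j _; apply: SM.
Qed.

Lemma sub_adjoin S t : is_subring S -> S `<=` adjoin S t.
Proof.
move=> rS x Sx; exists x%:P; last by rewrite hornerC.
by move=> i; rewrite coefC; case: (i == 0)%N => //; apply: subring0.
Qed.

Lemma adjoin_gen S t : is_subring S -> adjoin S t t.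
Proof.
move=> rS; exists 'X; last by rewrite hornerX.
move=> i; rewrite coefX; case: (i == 1)%N; last exact: subring0.
by case: rS.
Qed.

Lemma total_family (G : set (set L)) n (c : 'I_n -> L) :
  total_on G subset -> G !=set0 -> (forall i, exists2 X, G X & X (c i)) ->
  exists2 X, G X & forall i, X (c i).
Proof.
move=> totG [X0 GX0]; elim: n c => [|n IH] c Gc; first by exists X0 => // -[].
have [|X GX Xc] := IH (fun i => c (lift ord0 i)); first by move=> i; apply: Gc.
have [Y GY Yc] := Gc ord0.
have [XY|YX] := totG _ _ GX GY; [exists Y|exists X] => // i.
  by case: (unliftP ord0 i) => [j ->|-> //]; apply: XY.
by case: (unliftP ord0 i) => [j -> //|->]; apply: YX.
Qed.

Section Maximal.
Variables V N : set L.
Hypotheses (rV : is_subring V) (NV : N `<=` V) (N1 : ~ lin_span V N 1).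
Hypothesis maxV : forall W, is_subring W -> V `<=` W -> ~ lin_span W N 1 ->
  W `<=` V.
Let I := lin_span V N.

(** By maximality of [V], adjoining [t] makes [N] generate the unit ideal. *)
Lemma adjoin_unit t : ~ V t ->
  exists2 Q : {poly L}, (forall i, I Q`_i) & Q.[t] = 1.
Proof.
move=> nVt; have [|n1] := pselect (lin_span (adjoin V t) N 1); last first.
  by case: nVt; apply: (maxV (adjoin_subring t rV) (sub_adjoin t rV) n1);
    apply: adjoin_gen.
move=> [n [c [s [Vc Ns e]]]].
have /choice [P VP] : forall i, exists P : {poly L},
    (forall j, V P`_j) /\ c i = P.[t].
  by move=> i; have [P VP cP] := Vc i; exists P.
exists (\sum_i s i *: P i).
  move=> j; rewrite coef_sum; apply: lin_span_sum => i _.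
  by rewrite coefZ mulrC; apply: lin_span_term => //; case: (VP i).
rewrite horner_sum e; apply: eq_bigr => i _.
by rewrite hornerZ mulrC; case: (VP i) => _ ->.
Qed.

(** Otherwise adjoining the inverse of [s = 1 - b] to [V] puts a power of [s],
    which is [1] modulo [I], in [I]. *)
Lemma inv_one_sub b : I b -> 1 - b != 0 /\ V (1 - b)^-1.
Proof.
move=> Ib; have s0 : 1 - b != 0.
  by rewrite subr_eq0; apply: contra_notN N1 => /eqP ->.
split=> //; apply: contrapT => /adjoin_unit [Q IQ Q1].
have VI := lin_span_sub rV NV.
have [V1 VB VM] := rV.
have VX s n : V s -> V (s ^+ n).
  by move=> Vs; elim: n => [|n IH] //; rewrite exprS; apply: VM.
have Vs : V (1 - b) by apply: VB => //; apply: VI.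
have Is : I ((1 - b) ^+ size Q).
  rewrite -[_ ^+ _]mulr1 -[X in _ * X]Q1 horner_coef big_distrr /=.
  apply: lin_span_sum => i _; rewrite mulrCA mulrC exprVn.
  apply: lin_spanM (IQ i) => //; rewrite -[X in _ ^+ X](subnK (ltnW (ltn_ord i))).
  by rewrite exprD mulfK ?expf_neq0 //; apply: VX.
apply: N1; rewrite -[1](subrK ((1 - b) ^+ size Q)); apply: lin_spanD => //.
rewrite -{1}(expr1n _ (size Q)) subrXX subKr mulrC.
apply: lin_spanM => //; apply: subring_sum => // i _.
by rewrite expr1n mul1r; apply: VX.
Qed.

(** The relation in [t^-1], solved for its constant term, expresses [t ^+ n] by
    lower powers of [t] and so lowers the degree of the relation in [t]. *)
Lemma adjoin_descent t (Q R : {poly L}) n :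
  t != 0 -> (forall i, I Q`_i) -> (forall i, I R`_i) ->
  Q.[t] = 1 -> R.[t^-1] = 1 -> (size Q <= n.+1)%N -> (size R <= n.+1)%N ->
  exists P : {poly L}, [/\ forall i, I P`_i, P.[t] = 1 & (size P <= n)%N].
Proof.
move=> t0 IQ IR Qt Rt szQ szR.
have [s0 Vs] := inv_one_sub (IR 0%N).
have VI := lin_span_sub rV NV.
have [V1 VB VM] := rV.
exists (\poly_(i < n) (Q`_i + Q`_n / (1 - R`_0) * R`_(n - i))); split.
- move=> i; rewrite coef_poly; case: (i < n)%N; last exact: lin_span0.
  apply: lin_spanD; first exact: IQ.
  apply: lin_spanM (IR _) => //.
  by apply: VM => //; apply: VI; apply: IQ.
- have e : \sum_(i < n) R`_(n - i) * t ^+ i = (1 - R`_0) * t ^+ n.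
    have tn : t ^+ n != 0 by rewrite expf_neq0.
    rewrite -{1}Rt (horner_coef_wide _ szR) big_ord_recl expr0 mulr1 addrC addKr.
    rewrite big_distrl /= [RHS](reindex_inj rev_ord_inj) /=.
    apply: eq_bigr => i _; rewrite /bump /= add1n.
    have -> : (n - i.+1).+1 = (n - i)%N by rewrite subnSK.
    rewrite -mulrA; congr (_ * _).
    by rewrite exprVn -[X in _ * _ ^+ X](subnK (ltnW (ltn_ord i))) exprD mulKf
      // expf_neq0.
  rewrite horner_poly -{2}Qt (horner_coef_wide _ szQ) big_ord_recr /=.
  under eq_bigr do rewrite mulrDl -mulrA.
  by rewrite big_split -big_distrr /= e mulrA mulfVK.
- exact: size_poly.
Qed.

Lemma maximal_valuation t : t != 0 -> V t \/ V t^-1.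
Proof.
move=> t0; apply: contrapT => /not_orP [/adjoin_unit [Q IQ Qt] /adjoin_unit [R
  IR Rt]].
have [n] := ubnP (size Q + size R)%N.
elim: n t t0 Q R IQ IR Qt Rt => // n IH t t0 Q R IQ IR Qt Rt; rewrite ltnS => sz.
wlog RQ : t t0 Q R IQ IR Qt Rt sz / (size R <= size Q)%N.
  move=> W; have [RQ|/ltnW QR] := leqP (size R) (size Q); first exact: (W t t0 Q R).
  by apply: (W t^-1 _ R Q); rewrite ?invr_eq0 ?invrK // addnC.
case sQ: (size Q) => [|k].
  move/eqP: sQ; rewrite size_poly_eq0 => /eqP Q0.
  by move/eqP: Qt; rewrite Q0 horner0 eq_sym oner_eq0.
have [||P [IP Pt szP]] := @adjoin_descent t Q R k t0 IQ IR Qt Rt.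
- by rewrite sQ.
- by rewrite -sQ.
by apply: (IH t t0 P R) => //; apply: leq_trans sz; rewrite sQ ltn_add2r ltnS.
Qed.

End Maximal.

(** Chevalley extension, by Zorn: a subring maximal among those in which [N]
    does not generate the unit ideal is a valuation ring. *)
Lemma exists_valuation S N : is_subring S -> N `<=` S -> ~ lin_span S N 1 ->
  exists V, [/\ valuation_ring V, S `<=` V & ~ lin_span V N 1].
Proof.
move=> rS NS N1.
pose good W := [/\ is_subring W, S `<=` W & ~ lin_span W N 1].
have [|V0 [gV maxV]] := @Zorn_bigcup L (fun W => good (S `|` W)).
  move=> F FP totF.
  pose G : set (set L) := [set W | W = S \/ exists2 X, F X & W = S `|` X].
  have Ggood W : G W -> good W.
    by move=> [->|[X FX ->]]; [split | apply: FP].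
  have totG : total_on G subset.
    move=> X Y [->|[X' FX ->]] [->|[Y' FY ->]]; [by left| by left;
      apply: subsetUl | by right; apply: subsetUl|].
    by have [XY|YX] := totF _ _ FX FY; [left|right]; apply: setUS.
  have G0 : G !=set0 by exists S; left.
  have GU x : (S `|` \bigcup_(X in F) X) x -> exists2 X, G X & X x.
    move=> [Sx|[X FX Xx]]; first by exists S => //; left.
    by exists (S `|` X); [right; exists X|right].
  have UG W : G W -> W `<=` S `|` \bigcup_(X in F) X.
    move=> [->|[X FX ->]]; first exact: subsetUl.
    by apply: setUS => x Xx; exists X.
  have two x y : (S `|` \bigcup_(X in F) X) x -> (S `|` \bigcup_(X in F) X) y ->
      exists W, [/\ G W, W x & W y].
    move=> /GU [X GX Xx] /GU [Y GY Yy].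
    by have [XY|YX] := totG _ _ GX GY; [exists Y|exists X]; split=> //;
      [apply: XY|apply: YX].
  split; last 1 first.
  - move=> [n [c [s [/(_ _)/GU-Gc Ns e]]]].
    have [W GW Wc] := total_family totG G0 Gc.
    have [_ _] := Ggood W GW; apply.
    by exists n, c, s.
  - split.
    + by left; case: rS.
    + move=> x y /two H /H [W [GW Wx Wy]]; apply: (UG _ GW).
      by have [[_ WB _] _ _] := Ggood _ GW; apply: WB.
    + move=> x y /two H /H [W [GW Wx Wy]]; apply: (UG _ GW).
      by have [[_ _ WM] _ _] := Ggood _ GW; apply: WM.
  - exact: subsetUl.
have [rV SV V1] := gV.
exists (S `|` V0); split=> //; split; first exact: (proj1 (is_subringP _) rV).
move=> t t0; apply: (maximal_valuation (N := N)) => //.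
  exact: subset_trans SV.
move=> W rW VW W1; apply: contrapT => nWV; apply: (maxV W).
  split; first by apply: subset_trans VW; apply: subsetUr.
  by move=> WV; apply: nWV => x /WV; right.
have SW : S `<=` W by apply: subset_trans VW; apply: subsetUl.
by have -> : S `|` W = W by apply/setUidPr.
Qed.

End Valuations.

(** Valuative criterion of integral dependence on an ideal: were [1] not in the
    ideal that the [j / x] generate in the ring of the [P.[1 / x]], some
    valuation ring would contain this ring and keep every [j / x] a nonunit. *)
Lemma completion_integral (A : comNzRingType) (L : fieldType)
    (iota : {rmorphism A -> L}) (J : set A) (x : L) :
  is_ideal J -> x != 0 -> completion iota J x -> exists P : {poly A},
  [/\ P`_0 = 0, forall i, idealX J i P`_i & (map_poly iota P).[x^-1] = 1].
Proof.
move=> idJ x0 Jx.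
pose rees (P : {poly A}) := forall i, idealX J i P`_i.
pose S : set L := [set y | exists2 P, rees P & y = (map_poly iota P).[x^-1]].
pose N : set L := [set y | exists2 j, J j & y = iota j / x].
have idX n := idealX_ideal J n.
have rC a : rees a%:P.
  by move=> i; rewrite coefC; case: eqP => [-> //|_]; case: (idX i).
have rJX j : J j -> rees (j *: 'X).
  move=> Jj i; rewrite coefZ coefX; case: eqP => [->|_].
    by rewrite mulr1 idealX1.
  by rewrite mulr0; case: (idX i).
have rM P Q : rees P -> rees Q -> rees (P * Q).
  move=> rP rQ i; rewrite coefM; apply: ideal_sum => // j _.
  by have := idealX_mul (rP j) (rQ (i - j)%N); rewrite subnKC // leq_ord.
have rB P Q : rees P -> rees Q -> rees (P - Q).
  move=> rP rQ i; rewrite coefB; have [_ ID _] := idX i; apply: ID => //.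
  exact: ideal_opp.
have rS : is_subring S.
  split.
  - by exists 1%:P; [apply: rC|rewrite map_polyC hornerC /= rmorph1].
  - by move=> _ _ [P rP ->] [Q rQ ->]; exists (P - Q);
    [apply: rB|rewrite rmorphB hornerD hornerN].
  - by move=> _ _ [P rP ->] [Q rQ ->]; exists (P * Q);
    [apply: rM|rewrite rmorphM hornerM].
have NS : N `<=` S.
  move=> _ [j Jj ->]; exists (j *: 'X); first exact: rJX.
  by rewrite map_polyZ map_polyX hornerZ hornerX.
have [|N1] := pselect (lin_span S N 1); last first.
  have [V [vV SV V1]] := exists_valuation rS NS N1.
  case: V1; have [|n [c [s [Vc Js ex]]]] := Jx V vV.
    by move=> _ [a _ <-]; apply: SV; exists a%:P;
      [apply: rC|rewrite map_polyC hornerC].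
  exists n, c, (fun i => s i / x); split=> //.
    by move=> i; have [j Jj <-] := Js i; exists j.
  rewrite -(divff x0) {1}ex big_distrl /=; apply: eq_bigr => i _.
  by rewrite mulrA.
move=> [n [c [s [Sc Ns e]]]].
have /choice [P rP] : forall i, exists P, rees P /\ c i = (map_poly iota P).[x^-1].
  by move=> i; have [P rP cP] := Sc i; exists P.
have /choice [j Jj] : forall i, exists j, J j /\ s i = iota j / x.
  by move=> i; have [j Jj sj] := Ns i; exists j.
exists (\sum_i P i * (j i *: 'X)); split.
- rewrite coef_sum big1 // => i _.
  by rewrite coef0M coefZ coefX !mulr0.
- move=> i; rewrite coef_sum; apply: ideal_sum => // k _.
  by apply: rM; [case: (rP k)|apply: rJX; case: (Jj k)].
- rewrite rmorph_sum horner_sum e; apply: eq_bigr => i _.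
  rewrite rmorphM /= map_polyZ map_polyX hornerM hornerZ hornerX.
  by have [_ ->] := rP i; have [_ ->] := Jj i.
Qed.

(** * Complete integral closedness *)

Definition divides (A : comNzRingType) (d x : A) : Prop := exists a, x = d * a.

Lemma divides_trans (A : comNzRingType) (a b c : A) :
  divides a b -> divides b c -> divides a c.
Proof. by move=> [x ->] [y ->]; exists (x * y); rewrite mulrA. Qed.

Lemma dividesD (A : comNzRingType) (d a b : A) :
  divides d a -> divides d b -> divides d (a + b).
Proof. by move=> [x ->] [y ->]; exists (x + y); rewrite mulrDr. Qed.

Lemma divides_mull (A : comNzRingType) (d a b : A) :
  divides d b -> divides d (a * b).
Proof. by move=> [x ->]; exists (a * x); rewrite mulrCA. Qed.

Lemma dividesB (A : comNzRingType) (d a b : A) :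
  divides d a -> divides d b -> divides d (a - b).
Proof. by move=> da db; rewrite -mulN1r; apply: dividesD => //;
  apply: divides_mull. Qed.

Lemma divides_sum (A : comNzRingType) (d : A) (T : Type) (r : seq T)
    (P : pred T) (F : T -> A) :
  (forall i, P i -> divides d (F i)) -> divides d (\sum_(i <- r | P i) F i).
Proof.
move=> dF; apply: (big_ind (divides d)) => //; first by exists 0; rewrite mulr0.
by move=> _ _ [a ->] [b ->]; exists (a + b); rewrite mulrDr.
Qed.

(** Complete integral closedness, with fractions [p / q] cleared: the powers of
    [p / q] have a common denominator [e] only if [p / q] is in [A]. *)
Definition completely_closed (A : idomainType) : Prop :=
  forall p q e : A, e != 0 -> q != 0 ->
    (forall n, divides (q ^+ n) (e * p ^+ n)) -> divides q p.

Section CompletelyClosed.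

Lemma dvdp_of_dvdp_exp (A : idomainType) (p q e : {poly A}) : e != 0 -> q != 0 ->
  (forall n, q ^+ n %| e * p ^+ n) -> q %| p.
Proof.
move=> e0 q0 H; set g := gcdp p q.
have g0 : g != 0 by rewrite gcdp_eq0 (negPf q0) andbF.
have cop : coprimep (p %/ g) (q %/ g).
  by apply: coprimep_div_gcd; rewrite q0 orbT.
have pg := Pdiv.WeakIdomain.divpK (dvdp_gcdl p q).
have qg := Pdiv.WeakIdomain.divpK (dvdp_gcdr p q).
rewrite -/g in pg qg.
set a := _ ^+ _ in pg; set b := _ ^+ _ in qg.
have a0 : a != 0 by rewrite expf_neq0 ?lead_coef_eq0.
have b0 : b != 0 by rewrite expf_neq0 ?lead_coef_eq0.
have q'0 : q %/ g != 0.
  by apply: contra_neq q0 => q'0; move/eqP: qg;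
    rewrite q'0 mul0r eq_sym scale_poly_eq0 (negPf b0) => /eqP.
have q'e n : (q %/ g) ^+ n %| e.
  have copn : coprimep ((q %/ g) ^+ n) ((p %/ g) ^+ n).
    by apply/Pdiv.Idomain.coprimep_expl/Pdiv.Idomain.coprimep_expr;
      rewrite coprimep_sym.
  rewrite -(Pdiv.Idomain.Gauss_dvdpl _ copn).
  rewrite -(Pdiv.Idomain.dvdp_mul2r _ _ (expf_neq0 n g0)) -mulrA -!exprMn pg qg.
  by rewrite !exprZn -scalerAr (Pdiv.Idomain.dvdpZl _ _ (expf_neq0 n b0))
    (Pdiv.Idomain.dvdpZr _ _ (expf_neq0 n a0)).
have szq : (size (q %/ g)%R <= 1)%N.
  rewrite leqNgt; apply/negP => s2.
  have := Pdiv.Idomain.dvdp_leq e0 (q'e (size e)); rewrite leqNgt => /negP; apply.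
  have E0 : (0 < size e)%N by rewrite size_poly_gt0.
  have : (size e <= (size (q %/ g)%R).-1 * size e)%N by rewrite leq_pmull //
    -ltnS prednK // ltnW.
  rewrite -size_exp => eN; apply: leq_ltn_trans eN _.
  by rewrite prednK // size_poly_gt0 expf_neq0.
have [c qc] : exists c, q %/ g = c%:P.
  by exists (q %/ g)`_0; apply: size1_polyC.
have c0 : c != 0 by move: q'0; rewrite qc polyC_eq0.
apply/Pdiv.Idomain.dvdpP; exists (c * a, b *: (p %/ g)).
  by rewrite mulf_neq0.
by rewrite /= -scalerA -pg -scalerAl [RHS]scalerAr -qg qc mul_polyC scalerAr.
Qed.

(** A fraction of polynomials whose powers have a common denominator has a
    constant denominator [a], since over the fraction field of [A] polynomials
    form a principal ideal domain; its leading coefficients are then treated one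
    at a time. *)
Lemma poly_completely_closed (A : idomainType) :
  completely_closed A -> completely_closed {poly A}.
Proof.
move=> cA p q e e0 q0 H.
have /Pdiv.Idomain.dvdpP [[a g] /= a0 pg] : q %| p.
  apply: (dvdp_of_dvdp_exp e0 q0) => n; have [s ->] := H n.
  exact: Pdiv.Idomain.dvdp_mulIl.
suff [r gr] : divides a%:P g.
  exists r; have a0' : a%:P != 0 by rewrite polyC_eq0.
  by apply: (mulfI a0'); rewrite mul_polyC pg gr; ring.
have {H pg} : forall n, divides (a%:P ^+ n) (e * g ^+ n).
  move=> n; have [s es] := H n; exists s.
  apply: (mulfI (expf_neq0 n q0)); rewrite [RHS]mulrCA -es.
  transitivity (e * (g * q) ^+ n); first by rewrite exprMn; ring.
  by rewrite -pg -mul_polyC exprMn; ring.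
have [k] := ubnP (size g); elim: k g => // k IH g; rewrite ltnS => szg H.
have [g0|g0] := eqVneq g 0; first by exists 0; rewrite g0 mulr0.
have [c gc] : divides a (lead_coef g).
  apply: (cA _ _ (lead_coef e)); rewrite ?lead_coef_eq0 // => n.
  have [s es] := H n; exists (lead_coef s).
  by rewrite -lead_coef_exp -lead_coefM es -polyC_exp lead_coefM lead_coefC.
set t := c%:P * 'X^((size g).-1).
have [||r gr] := IH (g - a%:P * t).
- apply: leq_trans szg; rewrite ltnNge; apply/negP => szg.
  have sz : size g = (size g).-1.+1 by rewrite prednK // size_poly_gt0.
  have szt : (size (a%:P * t)%R <= size g)%N.
    by rewrite mulrA -polyCM -gc mul_polyC (leq_trans (size_scale_leq _ _)) //
      size_polyXn -sz.
  have szd : (size (g - a%:P * t)%R <= size g)%N.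
    by rewrite (leq_trans (size_polyD _ _)) // size_polyN geq_max leqnn.
  have : lead_coef (g - a%:P * t) = 0.
    rewrite lead_coefE; have -> : size (g - a%:P * t) = size g by apply/eqP;
      rewrite eqn_leq szd.
    by rewrite coefB mulrA -polyCM -gc mul_polyC coefZ coefXn eqxx mulr1
      -lead_coefE subrr.
  move/eqP; rewrite lead_coef_eq0 -size_poly_eq0 => /eqP d0.
  by move: szg; rewrite d0 leqn0 size_poly_eq0 (negPf g0).
- move=> n; rewrite exprBn big_distrr /=; apply: divides_sum => i _.
  have [s es] := H (n - i)%N; exists (s * ((-1) ^+ i * t ^+ i *+ 'C(n, i))).
  have -> : a%:P ^+ n = a%:P ^+ (n - i) * a%:P ^+ i.
    by rewrite -exprD subnK // leq_ord.
  rewrite !mulrnAr; congr (_ *+ _); rewrite exprMn.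
  transitivity ((e * g ^+ (n - i)) * ((-1) ^+ i * a%:P ^+ i * t ^+ i));
    first by ring.
  by rewrite es; ring.
by exists (r + t); rewrite mulrDr -gr; ring.
Qed.

End CompletelyClosed.

(** * Polynomials in several variables *)

Section MpolyMorphisms.
Variables (K : comNzRingType) (n : nat).

Lemma mpoly_gen_ind (P : {mpoly K[n]} -> Prop) :
  (forall c, P c%:MP) -> (forall i, P 'X_i) ->
  (forall p q, P p -> P q -> P (p + q)) ->
  (forall p q, P p -> P q -> P (p * q)) -> forall p, P p.
Proof.
move=> PC PX PD PM p; have P0 : P 0 by rewrite -mpolyC0.
rewrite (mpolyE p); apply: (big_ind P) => // m _.
rewrite -mul_mpolyC; apply: (PM) => //.
rewrite mpolyXE_id; have P1 : P 1 by rewrite -mpolyC1.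
apply: (big_ind P) => // i _; elim: (m i) => [|k IH] //.
by rewrite exprS; apply: PM.
Qed.

Lemma mpoly_congr (C : comNzRingType) (I : set C)
    (f g : {rmorphism {mpoly K[n]} -> C}) :
  is_ideal I -> (forall c, I (f c%:MP - g c%:MP)) ->
  (forall i, I (f 'X_i - g 'X_i)) -> forall p, I (f p - g p).
Proof.
case=> I0 ID IM IC IX; elim/mpoly_gen_ind => // p q Ip Iq.
  by rewrite !rmorphD opprD addrACA; apply: ID.
rewrite !rmorphM.
have -> : f p * f q - g p * g q = f q * (f p - g p) + g p * (f q - g q) by ring.
by apply: ID; apply: IM.
Qed.

Lemma zero_ideal (C : comNzRingType) : is_ideal [set 0 : C].
Proof.
split=> [//|x y /= -> ->|a x /= ->]; first by rewrite addr0.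
by rewrite mulr0.
Qed.

Lemma mpoly_ext (C : comNzRingType) (f g : {rmorphism {mpoly K[n]} -> C}) :
  (forall c, f c%:MP = g c%:MP) -> (forall i, f 'X_i = g 'X_i) -> f =1 g.
Proof.
move=> fgC fgX p; apply/eqP; rewrite -subr_eq0; apply/eqP.
apply: (mpoly_congr (zero_ideal C)) => [c|i] /=; first by rewrite fgC subrr.
by rewrite fgX subrr.
Qed.

End MpolyMorphisms.

Section LastVariable.
Variables (K : comNzRingType) (n : nat).

Definition mpoly_of_poly : {poly {mpoly K[n]}} -> {mpoly K[n.+1]} :=
  horner_eval 'X_ord_max \o map_poly (@mwiden n K).

HB.instance Definition _ := GRing.RMorphism.on mpoly_of_poly.

Lemma mpoly_of_polyC c : mpoly_of_poly c%:P = mwiden c.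
Proof. by rewrite /mpoly_of_poly /= /horner_eval map_polyC hornerC. Qed.

Lemma mpoly_of_polyX : mpoly_of_poly 'X = 'X_ord_max.
Proof. by rewrite /mpoly_of_poly /= /horner_eval map_polyX hornerX. Qed.

Lemma mwidenXU (i : 'I_n) :
  mwiden 'X_i = 'X_(widen_ord (leqnSn n) i) :> {mpoly K[n.+1]}.
Proof. by rewrite mwidenX mnmwiden1. Qed.

Lemma muniX_max : muni ('X_ord_max : {mpoly K[n.+1]}) = 'X.
Proof.
rewrite muniE msuppX big_seq1 mcoeffX eqxx scale1r mnm1E eqxx expr1.
have -> : [multinom U_(ord_max)%MM (widen_ord (leqnSn n) i) | i < n] = 0%MM.
  apply/mnmP => i; rewrite mnmE mnm1E mnm0E; case: eqP => // /(congr1 val) /= e.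
  by have := ltn_ord i; rewrite -e ltnn.
by rewrite mpolyX0 scale1r.
Qed.

Lemma muniX_widen (i : 'I_n) :
  muni ('X_(widen_ord (leqnSn n) i) : {mpoly K[n.+1]}) = ('X_i)%:P.
Proof.
rewrite muniE msuppX big_seq1 mcoeffX eqxx scale1r mnm1E.
have -> : (widen_ord (leqnSn n) i == ord_max) = false.
  by apply/eqP => /(congr1 val) /= e; have := ltn_ord i; rewrite e ltnn.
have -> : [multinom U_(widen_ord (leqnSn n) i)%MM (widen_ord (leqnSn n) j) | j
  < n] = U_(i)%MM.
  by apply/mnmP => j; rewrite mnmE !mnm1E.
by rewrite expr0 alg_polyC.
Qed.

Lemma muni_mwiden (p : {mpoly K[n]}) : muni (mwiden p) = p%:P.
Proof.
apply: (mpoly_ext (f := @muni n K \o @mwiden n K) (g := polyC)) => [c|i] /=.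
  by rewrite mwidenC muniC.
by rewrite mwidenXU muniX_widen.
Qed.

Lemma mpoly_of_polyK : cancel mpoly_of_poly (@muni n K).
Proof.
move=> p; rewrite /mpoly_of_poly /= /horner_eval horner_coef rmorph_sum /=.
rewrite (size_map_inj_poly (@inj_mwiden n K)) ?mwiden0 //.
rewrite [RHS](_ : p = \sum_(i < size p) p`_i *: 'X^i);
  last by rewrite -poly_def coefK.
apply: eq_bigr => i _; rewrite coef_map rmorphM rmorphXn /= muniX_max.
by rewrite muni_mwiden mul_polyC.
Qed.

Lemma muniK : cancel (@muni n K) mpoly_of_poly.
Proof.
apply: (mpoly_ext (f := mpoly_of_poly \o @muni n K) (g := idfun)) => [c|i] /=.
  by rewrite muniC mpoly_of_polyC mwidenC.
case: (unliftP ord_max i) => [j ->|->]; last by rewrite muniX_max mpoly_of_polyX.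
have -> : lift ord_max j = widen_ord (leqnSn n) j.
  by apply: ord_inj; rewrite lift_max.
by rewrite muniX_widen mpoly_of_polyC mwidenXU.
Qed.

End LastVariable.

Lemma mpoly_completely_closed (K : fieldType) n : completely_closed {mpoly K[n]}.
Proof.
elim: n => [|n IH] p q e e0 q0 H.
  exists (p * (q@_0%MM)^-1%:MP).
  have qC := mpolyKC q.
  have q0' : q@_0%MM != 0 by rewrite -(mpolyC_eq0 0) qC.
  by rewrite -{1}qC mulrCA -mpolyCM divff // mpolyC1 mulr1.
have inj0 x : x != 0 -> muni x != 0 :> {poly {mpoly K[n]}}.
  by rewrite (raddf_eq0 _ (can_inj (@muniK K _))).
have [|s] := poly_completely_closed IH (inj0 _ e0) (inj0 _ q0) (p := muni p).
  move=> k; have [s es] := H k; exists (muni s).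
  by have := congr1 (@muni n K) es; rewrite !rmorphM !rmorphXn.
move=> ep; exists (mpoly_of_poly s).
by apply: (can_inj (@muniK K n)); rewrite rmorphM /= mpoly_of_polyK.
Qed.

(** The powers of an integral element lie in a finitely generated module, hence
    have a common denominator. *)
Lemma integral_divides (A : idomainType) (L : fieldType)
    (kappa : {rmorphism A -> L}) (p q : A) :
  completely_closed A -> injective kappa -> q != 0 ->
  integralOver kappa (kappa p / kappa q) -> divides q p.
Proof.
move=> cA inj q0 [P monP rootP].
have kq0 : kappa q != 0 by rewrite (raddf_eq0 _ inj).
apply: (cA p q (q ^+ size P)) => //; first by rewrite expf_neq0.
move=> n.
have [Q szQ eQ] : exists2 Q : {poly A}, (size Q <= size P)%N &
    (kappa p / kappa q) ^+ n = (map_poly kappa Q).[kappa p / kappa q].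
  exists (Pdiv.CommonRing.rmodp 'X^n P).
    by apply: ltnW; rewrite Pdiv.CommonRing.ltn_rmodpN0 // monic_neq0.
  have e := Pdiv.RingMonic.rdivp_eq monP 'X^n.
  rewrite -hornerXn -(map_polyXn kappa) {1}e rmorphD rmorphM hornerD hornerM.
  by rewrite (eqP rootP) mulr0 add0r.
exists (\sum_(i < size P) Q`_i * p ^+ i * q ^+ (size P - i)).
apply: inj; rewrite rmorphM !rmorphXn rmorphM rmorphXn rmorph_sum /=.
have e : kappa p = kappa p / kappa q * kappa q by rewrite mulfVK.
rewrite {1}e exprMn eQ mulrC -mulrA mulrA [_ * kappa q ^+ n]mulrC -!mulrA;
  congr (_ * _).
rewrite (horner_coef_wide (n := size P)); last first.
  by apply: leq_trans (size_poly _ _) szQ.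
rewrite mulrC big_distrr /=; apply: eq_bigr => i _.
rewrite coef_map !rmorphM !rmorphXn expr_div_n -{1}(subnK (ltnW (ltn_ord i))) exprD.
by field; rewrite expf_neq0.
Qed.

(** * Roots of unity *)

Section RootsOfUnity.

Lemma exists_irreducible_factor (L : fieldType) (p : {poly L}) :
  (1 < size p)%N -> exists2 q, irreducible_poly q & q %| p.
Proof.
have [n] := ubnP (size p); elim: n p => // n IH p; rewrite ltnS => szp p1.
have [irr|nirr] := pselect (irreducible_poly p); first by exists p.
have p0 : p != 0 by rewrite -size_poly_gt0 ltnW.
have [q [q1 qp nqp]] : exists q : {poly L}, [/\ size q != 1%N, q %| p & ~~ (q
  %= p)].
  apply: contrapT => H; apply: nirr; split=> // q q1 qp.
  by apply/negPn/negP => nqp; apply: H; exists q.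
have q0 : q != 0 by apply: contraNneq p0 => q0; move: qp; rewrite q0 dvd0p.
have szqp : (size q < size p)%N.
  by rewrite ltn_neqAle dvdp_leq // andbT; move: nqp; rewrite -dvdp_size_eqp.
have [||r irr rq] := IH q.
- exact: leq_trans szqp szp.
- by rewrite ltn_neqAle eq_sym q1 size_poly_gt0.
by exists r => //; apply: dvdp_trans qp.
Qed.

Lemma exists_splitting_field (L : fieldType) (p : {poly L}) : p != 0 ->
  exists (E : fieldType) (phi : {rmorphism L -> E}) (rs : seq E),
    map_poly phi p = phi (lead_coef p) *: \prod_(r <- rs) ('X - r%:P).
Proof.
have [n] := ubnP (size p); elim: n L p => // n IH L p; rewrite ltnS => szp p0.
have [sz1|sz1] := leqP (size p) 1.
  exists L, idfun, [::]; rewrite big_nil (size1_polyC sz1).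
  by rewrite map_polyC /= lead_coefC alg_polyC.
have [q irr qp] := exists_irreducible_factor sz1.
have [E [psi [z qz]]] : exists (E : fieldType) (psi : {rmorphism L -> E}) (z : E),
    root (map_poly psi q) z.
  by have [E _ [z qz _]] := irredp_FAdjoin irr; exists E, (in_alg E), z.
have pz : root (map_poly psi p) z by apply: root_dvdp qz; rewrite dvdp_map.
have [p1 ep] := factor_theorem _ _ pz.
have p10 : p1 != 0.
  by apply: contraNneq p0 => e; move: ep; rewrite e mul0r => /eqP;
    rewrite map_poly_eq0.
have szp1 : (size p1 < n)%N.
  have := congr1 (fun r : {poly E} => size r) ep;
    rewrite size_map_poly size_mul ?polyXsubC_eq0 //.
  by rewrite size_XsubC addn2 /= => e; rewrite -e.
have [E' [phi [rs e]]] := IH E p1 szp1 p10.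
exists E', (phi \o psi), (phi z :: rs).
rewrite map_poly_comp ep rmorphM /= e big_cons rmorphB /= map_polyX map_polyC /=.
have -> : lead_coef p1 = psi (lead_coef p).
  rewrite -lead_coef_map_inj ?ep ?lead_coef_Mmonic ?monicXsubC //.
  - exact: fmorph_inj.
  - exact: rmorph0.
by rewrite -scalerAl mulrC.
Qed.

Lemma exists_prim_root (L : fieldType) (m : nat) : m%:R != 0 :> L ->
  exists (E : fieldType) (phi : {rmorphism L -> E}) (zeta : E),
    m.-primitive_root zeta.
Proof.
move=> m0; have m_gt0 : (0 < m)%N by case: m m0 => //; rewrite eqxx.
have mon : ('X^m - 1%:P : {poly L}) \is monic by apply: monicXnsubC.
have [E [phi [rs]]] := exists_splitting_field (monic_neq0 mon).
rewrite (eqP mon) (rmorph1 phi) scale1r rmorphB /= map_polyXn map_polyC /=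
  (rmorph1 phi) => e.
have m0E : m%:R != 0 :> E by rewrite -(rmorph_nat phi) fmorph_eq0.
have [|||zeta _ prim] := hasP (@has_prim_root E m rs m_gt0 _ _ _).
- apply/allP => x xrs; rewrite /root_of_unity /root e.
  by rewrite -/(root _ _) root_prod_XsubC.
- by rewrite -separable_prod_XsubC -e; apply: separable_Xn_sub_1.
- have := congr1 (fun r : {poly E} => size r) e;
  rewrite size_prod_XsubC size_XnsubC // => -[->].
  exact: leqnn.
by exists E, phi, zeta.
Qed.

(** Orthogonality of the characters of the cyclic group of order [m]; the
    exponent [m - j] stands for [- j]. *)
Lemma sum_prim_root (E : fieldType) (m : nat) (zeta : E) (i j : 'I_m) :
  m.-primitive_root zeta ->
  \sum_(c < m) zeta ^+ (c * i + c * (m - j)) = (i == j)%:R * m%:R.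
Proof.
move=> prim; set k := (i + (m - j))%N.
have -> : \sum_(c < m) zeta ^+ (c * i + c * (m - j)) = \sum_(c < m) (zeta ^+ k)
  ^+ c.
  by apply: eq_bigr => c _; rewrite -mulnDr mulnC exprM.
have zk1 : (zeta ^+ k == 1) = (i == j).
  rewrite -(prim_order_dvd prim) /k -val_eqE /=.
  have := ltn_ord i; have := ltn_ord j; move: (val i) (val j) => {k} {}i {}j jm im.
  apply/idP/eqP => [|->]; last by rewrite subnKC // ltnW.
  case: (ltngtP i j) => // [ij|ji].
    by rewrite gtnNdvd //; lia.
  have -> : (i + (m - j) = (i - j) + m)%N by lia.
  by rewrite dvdn_addl // gtnNdvd //; lia.
rewrite -zk1; have [->|zk] := eqVneq (zeta ^+ k) 1.
  under eq_bigr do rewrite expr1n.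
  by rewrite sumr_const card_ord mul1r.
have zk' : zeta ^+ k - 1 != 0 by rewrite subr_eq0.
apply: (mulfI zk'); rewrite -subrX1 mul0r mulr0 exprAC (prim_expr_order prim).
by rewrite expr1n subrr.
Qed.

End RootsOfUnity.
(** * Eisenstein's criterion *)

Definition prime_elt (A : comNzRingType) (a : A) : Prop :=
  ~ divides a 1 /\
  forall x y, divides a (x * y) -> divides a x \/ divides a y.

Lemma divides_Xn_reg (A : idomainType) k (g P : {poly A}) :
  g`_0 != 0 -> divides 'X^k (g * P) -> divides 'X^k P.
Proof.
move=> g0; elim: k => [|k IH]; first by exists P; rewrite mul1r.
move=> [a ea]; have [|b eb] := IH; first by exists ('X * a);
  rewrite ea exprSr mulrA.
have gb : g * b = 'X * a.
  have Xk : ('X^k : {poly A}) != 0 by rewrite expf_neq0 // polyX_eq0.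
  by apply: (mulfI Xk); rewrite mulrCA -eb ea exprSr mulrA.
have : b`_0 = 0.
  have := congr1 (fun r : {poly A} => r`_0) gb; rewrite coef0M coefXM /=.
  by move=> /eqP; rewrite mulf_eq0 (negPf g0) => /eqP.
rewrite -horner_coef0 => /eqP/factor_theorem [c ec].
by exists c; rewrite eb ec subr0 exprSr; ring.
Qed.

Section MonicDivision.
Variables (A : idomainType) (G : {poly A}).
Hypothesis monG : G \is monic.

Lemma monic_division (P : {poly A}) : exists Q R : {poly A}, P = G * Q + R /\
  (size R < size G)%N.
Proof.
exists (Pdiv.CommonRing.rdivp P G), (Pdiv.CommonRing.rmodp P G); split.
  by rewrite mulrC; apply: Pdiv.RingMonic.rdivp_eq.
by rewrite Pdiv.CommonRing.ltn_rmodpN0 // monic_neq0.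
Qed.

Lemma monic_divides_small (R : {poly A}) :
  (size R < size G)%N -> divides G R -> R = 0.
Proof.
move=> szR [Q eR]; apply/eqP; rewrite eR mulf_eq0 (negPf (monic_neq0 monG)) /=.
apply: contraLR szR => Q0; rewrite eR -leqNgt mulrC size_Mmonic //.
by move: Q0; rewrite -size_poly_gt0; case: (size Q) => // k _;
  rewrite addSn leq_addl.
Qed.

Lemma monic_cancelC c (P : {poly A}) : c != 0 -> divides G (c%:P * P) ->
  divides G P.
Proof.
move=> c0 GP; have [Q [R [eP szR]]] := monic_division P.
suff R0 : R = 0 by exists Q; rewrite eP R0 addr0.
have cR : divides G (c%:P * R).
  have -> : c%:P * R = c%:P * P - G * (c%:P * Q) by rewrite eP; ring.
  by apply: dividesB => //; exists (c%:P * Q).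
have := monic_divides_small _ cR; rewrite size_Cmul // => /(_ szR) /eqP.
by rewrite mulf_eq0 polyC_eq0 (negPf c0) => /eqP.
Qed.

End MonicDivision.

Lemma polyC_divides (A : idomainType) (c : A) (P : {poly A}) :
  (forall i, divides c P`_i) -> divides c%:P P.
Proof.
move=> /choice [q cq]; exists (\poly_(i < size P) q i).
apply/polyP => i; rewrite coefCM coef_poly.
by case: ltnP => [_|sz]; [apply: cq | rewrite mulr0 nth_default].
Qed.

(** Eisenstein at a prime [pi] dividing [f] exactly once, in a form that yields
    primality over a ring that need not be factorial. *)
Section Eisenstein.
Variables (A : idomainType) (pi f g : A) (m : nat).
Hypotheses (cA : completely_closed A) (m_gt0 : (0 < m)%N) (pi0 : pi != 0).
Hypotheses (pr : prime_elt pi) (efg : f = pi * g) (ng : ~ divides pi g).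
Let G : {poly A} := 'X^m - f%:P.

Let monG : G \is monic. Proof. exact: monicXnsubC. Qed.
Let szG : size G = m.+1. Proof. exact: size_XnsubC. Qed.

Let g0 : g != 0.
Proof. by apply: contra_notN ng => /eqP ->; exists 0; rewrite mulr0. Qed.

Lemma cancelX (P : {poly A}) : divides G ('X * P) -> divides G P.
Proof.
move=> [Q eQ]; have : Q`_0 = 0.
  have := congr1 (fun p : {poly A} => p`_0) eQ; rewrite coefXM /=.
  rewrite coef0M coefB coefXn coefC eqxx -(prednK m_gt0) /= sub0r => /eqP.
  rewrite eq_sym mulf_eq0 oppr_eq0 efg mulf_eq0 (negPf pi0) (negPf g0) /=.
  by move/eqP.
rewrite -horner_coef0 => /eqP/factor_theorem [Q1 eQ1].
exists Q1; have X0 : 'X != 0 :> {poly A} by rewrite polyX_eq0.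
by apply: (mulfI X0); rewrite eQ eQ1 subr0; ring.
Qed.

Lemma extract_prime (n : nat) (P : {poly A}) : ~ divides (pi ^+ n)%:P P ->
  exists (v : nat) (P1 : {poly A}),
    P = (pi ^+ v)%:P * P1 /\ exists i, ~ divides pi P1`_i.
Proof.
elim: n P => [|n IH] P; first by case; exists P; rewrite expr0 mul1r.
move=> nP; have [H|] := pselect (forall i, divides pi P`_i); last first.
  by move=> /existsNP H; exists 0%N, P; rewrite expr0 mul1r.
have [P' eP] := polyC_divides H.
have [|v [P1 [eP' H1]]] := IH P'.
  by move=> [Q eQ]; apply: nP; exists Q; rewrite eP eQ exprS polyCM mulrA.
by exists v.+1, P1; split=> //; rewrite eP eP' exprS polyCM mulrA.
Qed.

(** Multiplying by [g] turns [pi] into ['X ^+ m] modulo [G], so that the lowest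
    coefficient prime to [pi] becomes the lowest coefficient of all. *)
Lemma initial_form (P : {poly A}) : ~ divides G P -> exists v i (P' : {poly A}),
  divides G (g%:P * P - (pi ^+ v)%:P * 'X^i * P') /\ ~ divides pi P'`_0.
Proof.
move=> nP; have [Q [R [eP szR]]] := monic_division monG P.
have R0 : R != 0.
  by apply: contra_notN nP => /eqP R0; exists Q; rewrite eP R0 addr0.
have [n nR] : exists n, ~ divides (pi ^+ n)%:P R.
  apply/existsNP => H; case: pr => npi1 _; apply: npi1.
  apply: (cA (e := lead_coef R)) => //; first by rewrite lead_coef_eq0.
  move=> n; rewrite expr1n mulr1; have [S eS] := H n.
  by exists S`_(size R).-1; rewrite lead_coefE {1}eS coefCM.
have [v [R1 [eR1 H]]] := extract_prime nR.
have exH : exists i, `[< ~ divides pi R1`_i >].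
  by have [i Hi] := H; exists i; apply/asboolP.
case: (ex_minnP exH) => i /asboolP Hi mini.
have szR1 : (i < m)%N.
  have eRR1 : size R = size R1 by rewrite eR1 size_Cmul // expf_neq0.
  have : (i < size R1)%N.
    by rewrite ltnNge; apply: contra_notN Hi => sz; rewrite nth_default //;
      exists 0; rewrite mulr0.
  by rewrite -eRR1 => iR; move: szR; rewrite szG ltnS; apply: leq_trans.
have [Plow elow] : divides pi%:P (take_poly i R1).
  apply: polyC_divides => j; rewrite coef_take_poly; case: ltnP => ji;
    last by exists 0; rewrite mulr0.
  by apply: contrapT => /asboolP /mini; rewrite leqNgt ji.
exists v, i, ('X^(m - i) * Plow + g%:P * drop_poly i R1); split.
  exists (g%:P * Q - (pi ^+ v)%:P * Plow).
  have eX : 'X^m = 'X^i * 'X^(m - i) :> {poly A}.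
    by rewrite -exprD subnKC // ltnW.
  have eR : R1 = pi%:P * Plow + drop_poly i R1 * 'X^i.
    by rewrite -elow poly_take_drop.
  rewrite eP eR1 {1}eR /G mulrBl eX efg polyCM; ring.
rewrite coefD coefXnM subn_gt0 szR1 add0r coefCM coef_drop_poly add0n.
by move=> /(proj2 pr) [].
Qed.

Lemma eisenstein_prime : prime_elt G.
Proof.
have nG1 : ~ divides G 1.
  move=> G1; have := monic_divides_small monG _ G1; rewrite size_poly1 szG ltnS.
  by move=> /(_ m_gt0) /eqP; rewrite oner_eq0.
split=> // P Q GPQ; apply: contrapT => /not_orP [nP nQ].
have [v [i [P' [GP P'0]]]] := initial_form nP.
have [w [j [Q' [GQ Q'0]]]] := initial_form nQ.
have : divides G ((pi ^+ (v + w))%:P * ('X^(i + j) * (P' * Q'))).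
  have -> : (pi ^+ (v + w))%:P * ('X^(i + j) * (P' * Q')) =
    g%:P * g%:P * (P * Q) - g%:P * P * (g%:P * Q - (pi ^+ w)%:P * 'X^j * Q')
    - (pi ^+ w)%:P * 'X^j * Q' * (g%:P * P - (pi ^+ v)%:P * 'X^i * P').
    by rewrite !exprD polyCM; ring.
  by apply: dividesB; [apply: dividesB|]; apply: divides_mull.
move/(monic_cancelC monG (expf_neq0 _ pi0)).
elim: (i + j)%N => [|k IH]; last by rewrite exprS -mulrA => /cancelX.
rewrite mul1r => -[H eH].
have : divides pi (P'`_0 * Q'`_0).
  rewrite -coef0M eH coef0M coefB coefXn coefC eqxx -(prednK m_gt0) /= sub0r.
  by rewrite efg; exists (- g * H`_0); ring.
by move=> /(proj2 pr) [].
Qed.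

End Eisenstein.

(** * Integral elements of a radical extension *)

Lemma integral_radical (A : idomainType) (L : fieldType)
    (kappa : {rmorphism A -> L}) (a : A) (n : nat) (u : L) :
  (0 < n)%N -> u ^+ n = kappa a -> integralOver kappa u.
Proof.
move=> n_gt0 un; exists ('X^n - a%:P); first exact: monicXnsubC.
rewrite /root rmorphB /= map_polyXn map_polyC /= hornerD hornerN hornerXn.
by rewrite hornerC un subrr.
Qed.

Lemma integral_exp (A : idomainType) (L : fieldType)
    (kappa : {rmorphism A -> L}) (n : nat) (u : L) :
  integralOver kappa u -> integralOver kappa (u ^+ n).
Proof.
move=> intu; elim: n => [|n IH]; first exact: integral1.
by rewrite exprS; apply: integral_mul.
Qed.

(** Integral elements of the extension generated by an [m]-th root [z] of a
    squarefree [f]: squarefreeness enters as [f_radical]. *)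
Section Kummer.
Variables (A : idomainType) (L : fieldType) (kappa : {rmorphism A -> L}).
Variables (m : nat) (f : A) (z : L).
Hypotheses (cA : completely_closed A) (inj : injective kappa).
Hypotheses (m_unit : m%:R \is a @GRing.unit A) (f0 : f != 0).
Hypotheses (f_radical : forall e n, divides f (e ^+ n) -> divides f e).
Hypotheses (zm : z ^+ m = kappa f).
Hypothesis free_z : forall r : {poly A}, (size r <= m)%N ->
  (map_poly kappa r).[z] = 0 -> r = 0.

Let m_gt0 : (0 < m)%N.
Proof. by case: m m_unit => //; rewrite unitr0. Qed.

(** As the powers of [z] are free, the polynomials vanishing at [z] are the
    multiples of ['X^m - f%:P], which vanishes at [w] too. *)
Lemma conjugate_root (E : fieldType) (phi : {rmorphism L -> E}) (w : E)
    (Q : {poly A}) : w ^+ m = phi (kappa f) -> (map_poly kappa Q).[z] = 0 ->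
  (map_poly (phi \o kappa) Q).[w] = 0.
Proof.
move=> wm Qz; have mon : ('X^m - f%:P : {poly A}) \is monic by apply: monicXnsubC.
have [S [R [eQ szR]]] := monic_division mon Q.
have G0 (E' : fieldType) (psi : {rmorphism A -> E'}) t : t ^+ m = psi f ->
    (map_poly psi ('X^m - f%:P)).[t] = 0.
  by move=> tm; rewrite rmorphB /= map_polyXn map_polyC /= hornerD hornerN
    hornerXn hornerC tm subrr.
have R0 : R = 0.
  apply: free_z; first by move: szR; rewrite size_XnsubC.
  by move: Qz; rewrite eQ rmorphD rmorphM hornerD hornerM G0 // mul0r add0r.
by rewrite eQ R0 addr0 rmorphM hornerM G0 // mul0r.
Qed.

(** Averaging the conjugates of [y] over the roots of unity isolates each term
    of its expansion in powers of [z]. *)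
Lemma integral_terms (d : A) (r : {poly A}) : d != 0 -> (size r <= m)%N ->
  integralOver kappa ((map_poly kappa r).[z] / kappa d) ->
  exists (E : fieldType) (phi : {rmorphism L -> E}), forall i : 'I_m,
    integralOver (phi \o kappa)
      (phi (kappa (m%:R * r`_i) / kappa d * z ^+ i)).
Proof.
move=> d0 szr [P monP rootP].
have kd0 : kappa d != 0 by rewrite (raddf_eq0 _ inj).
have mL : m%:R != 0 :> L.
  by rewrite -(rmorph_nat kappa); have := rmorph_unit kappa m_unit; rewrite unitfE.
have [E [phi [zeta prim]]] := exists_prim_root mL.
exists E, phi => i; set ka := phi \o kappa.
have kad0 : ka d != 0 by rewrite fmorph_eq0.
pose y (c : nat) := (map_poly ka r).[zeta ^+ c * phi z] / ka d.
have inty c : integralOver ka (y c).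
  exists P => //; pose N := (size P).-1.
  (* [d ^+ N * P.[r / d]], with denominators cleared *)
  pose Q := \sum_(j < size P) (P`_j * d ^+ (N - j)) *: r ^+ j.
  have key (F : fieldType) (psi : {rmorphism A -> F}) t : psi d != 0 ->
      (map_poly psi Q).[t] =
      psi d ^+ N * (map_poly psi P).[(map_poly psi r).[t] / psi d].
    move=> pd0; rewrite rmorph_sum horner_sum /=.
    rewrite (horner_coef_wide (n := size P)) ?size_poly // big_distrr /=.
    apply: eq_bigr => j _; rewrite coef_map map_polyZ hornerZ rmorphM !rmorphXn /=.
    rewrite horner_exp expr_div_n.
    have jN : (j <= N)%N by rewrite /N -ltnS prednK // (leq_trans _ (ltn_ord j)).
    rewrite -{2}(subnK jN) exprD.
    by field; rewrite expf_neq0.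
  have Qz : (map_poly kappa Q).[z] = 0 by rewrite key // (eqP rootP) mulr0.
  have := conjugate_root (phi := phi) (w := zeta ^+ c * phi z) _ Qz.
  rewrite exprMn exprAC (prim_expr_order prim) expr1n mul1r -rmorphXn zm.
  move=> /(_ erefl); rewrite key // => /eqP.
  by rewrite mulf_eq0 expf_eq0 (negPf kad0) andbF => e; exact: e.
have -> : phi (kappa (m%:R * r`_i) / kappa d * z ^+ i) =
    \sum_(c < m) zeta ^+ (c * (m - i)) * y c.
  have yE c : y c = \sum_(j < m) ka r`_j * (zeta ^+ c * phi z) ^+ j / ka d.
    rewrite /y (horner_coef_wide (n := m)) ?(leq_trans (size_poly _ _)) //.
    by rewrite big_distrl /=; apply: eq_bigr => j _; rewrite coef_map.
  transitivity (\sum_(c < m) \sum_(j < m)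
    ka r`_j / ka d * phi z ^+ j * zeta ^+ (c * j + c * (m - i))); last first.
    apply: eq_bigr => c _; rewrite yE big_distrr /=.
    by apply: eq_bigr => j _; rewrite exprMn exprD -exprM; ring.
  rewrite exchange_big /= (bigD1 i) //= [X in _ + X]big1 ?addr0.
    rewrite -mulr_sumr sum_prim_root // eqxx mul1r.
    by rewrite !rmorphM fmorphV rmorphXn !rmorph_nat /=; ring.
  move=> j ji; rewrite -mulr_sumr sum_prim_root // (negPf ji) mul0r.
  by rewrite mulr0.
apply: (big_ind (integralOver ka)).
- exact: integral0.
- exact: integral_add.
move=> c _; apply: integral_mul => //.
apply: (integral_radical (a := 1) m_gt0).
by rewrite rmorph1 exprAC (prim_expr_order prim) expr1n.
Qed.

(** If the term [b / d * z ^+ i] is integral, then multiplying it by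
    [z ^+ (m - i)] shows that [b * f / d] is some [e] in [A], and the [m]-th power
    of the term is [e ^+ m / f ^+ (m - i)]. As [i < m], [f] divides [e ^+ m],
    hence [e], so that [d] divides [b]. *)
Lemma integral_kummer (d : A) (r : {poly A}) : d != 0 -> (size r <= m)%N ->
  integralOver kappa ((map_poly kappa r).[z] / kappa d) -> divides d%:P r.
Proof.
move=> d0 szr /(integral_terms d0 szr) [E [phi intE]].
apply: polyC_divides => i; have [im|mi] := ltnP i m; last first.
  by exists 0; rewrite mulr0 nth_default // (leq_trans szr).
have {intE} := intE (Ordinal im); set ka := phi \o kappa => /= int.
have kainj : injective ka by move=> u v /fmorph_inj/inj.
have ka0 u : u != 0 -> ka u != 0 by rewrite (raddf_eq0 _ kainj).
have [b be] : exists b, b = m%:R * r`_i by exists (m%:R * r`_i).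
rewrite -be in int.
have phiz : phi z ^+ m = ka f by rewrite -rmorphXn zm.
have [e eb] : divides d (b * f).
  apply: (integral_divides cA kainj d0).
  have -> : ka (b * f) / ka d = phi (kappa b / kappa d * z ^+ i) * phi z ^+ (m - i).
    rewrite !rmorphM fmorphV rmorphXn /= -mulrA -exprD subnKC ?(ltnW im) // phiz.
    by rewrite /ka /= !rmorphM mulrAC.
  by apply: integral_mul => //; apply/integral_exp/(integral_radical m_gt0 phiz).
have : divides f (e ^+ m).
  apply: (integral_divides cA kainj f0).
  have -> : ka (e ^+ m) / ka f = phi (kappa b / kappa d * z ^+ i) ^+ m * ka f
    ^+ (m - i.+1).
    have -> : kappa b / kappa d = kappa e / kappa f.
      have kd0 : kappa d != 0 by rewrite (raddf_eq0 _ inj).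
      have kf0 : kappa f != 0 by rewrite (raddf_eq0 _ inj).
      by apply: (mulIf kf0); rewrite mulfVK // mulrAC -rmorphM eb rmorphM mulrC
        mulKf.
    rewrite -rmorphXn exprMn expr_div_n exprAC zm !rmorphM fmorphV !rmorphXn /=.
    rewrite -[in X in _ / X * _](subnKC im) -/ka.
    have kaf0 := ka0 f f0; have e2 : (i.+1 + (m - i.+1) = i + (m - i.+1) + 1)%N
      by lia.
    rewrite e2 !exprD expr1.
    rewrite /ka /= !rmorphXn /= in kaf0 *.
    by field; rewrite kaf0 !expf_neq0.
  apply: integral_mul; first exact: integral_exp.
  by rewrite -rmorphXn; apply: integral_id.
move=> /f_radical [e' ee].
have eb' : b = d * e'.
  by apply: (mulIf f0); rewrite eb ee; ring.
exists (m%:R^-1 * e'); apply: (can_inj (mulKr m_unit)).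
by rewrite -be eb' mulrCA mulVKr.
Qed.
End Kummer.

(** * Linear forms and their products *)

Section LinearForms.
Variable K : fieldType.

Lemma linear_form_sum n (F : {mpoly K[n]}) :
  linear_form F -> F = \sum_i F@_(U_(i)) *: 'X_i.
Proof.
move=> [_ homF]; apply/mpolyP => u; rewrite raddf_sum /=.
have [/mdeg1P [j /eqP ->]|d1] := boolP (mdeg u == 1%N).
  rewrite (bigD1 j) //= big1 => [|i ij].
    by rewrite mcoeffZ mcoeffX eqxx mulr1 addr0.
  by rewrite mcoeffZ mcoeffX eq_mnm1 (negPf ij) mulr0.
rewrite (dhomog_nemf_coeff homF) // big1 // => i _.
rewrite mcoeffZ mcoeffX; case: eqP => [e|_]; last by rewrite mulr0.
by move: d1; rewrite -e mdeg1.
Qed.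

Lemma linear_form_coef n (F : {mpoly K[n]}) :
  linear_form F -> exists i, F@_(U_(i)) != 0.
Proof.
move=> linF; apply: contrapT => H; case: (linF) => /eqP F0 _; apply: F0.
rewrite (linear_form_sum linF) big1 // => i _.
have [->|c0] := eqVneq F@_(U_(i)) 0; first by rewrite scale0r.
by case: H; exists i.
Qed.

Lemma linear_formX n (i : 'I_n) : linear_form ('X_i : {mpoly K[n]}).
Proof.
split; last by rewrite dhomogX /= mdeg1.
by rewrite -msize_poly_eq0 msizeX.
Qed.

Lemma linear_form_mwiden n (F : {mpoly K[n]}) :
  linear_form F -> linear_form (mwiden F).
Proof.
move=> linF; case: (linF) => F0 _; split.
  by rewrite (raddf_eq0 _ (@inj_mwiden n K)).
rewrite (linear_form_sum linF) rmorph_sum /=; apply: rpred_sum => i _.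
by rewrite mwidenZ; apply/rpredZ; rewrite mwidenXU dhomogX /= mdeg1.
Qed.

(** The substitution that solves [F = 0] for one variable is a ring morphism
    with kernel generated by [F]. *)
Lemma linear_form_prime n (F : {mpoly K[n]}) : linear_form F -> prime_elt F.
Proof.
move=> linF; have [j cj0] := linear_form_coef linF.
have eF := linear_form_sum linF; set c := fun i => F@_(U_(i)) in eF.
pose lq := [tuple 'X_i - (i == j)%:R *: ((c j)^-1 *: F) | i < n].
pose sigma : {rmorphism _ -> _} := comp_mpoly lq.
have sX i : sigma 'X_i = 'X_i - (i == j)%:R *: ((c j)^-1 *: F).
  by rewrite /sigma /= comp_mpolyXU -tnth_nth tnth_mktuple.
have sF : sigma F = 0.
  rewrite {1}eF rmorph_sum /=.
  under eq_bigr => i _ do rewrite -mul_mpolyC rmorphM /= comp_mpolyC sX mulrBr.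
  rewrite sumrB {1}(_ : \sum_i _ = F); last first.
    by rewrite {2}eF; apply: eq_bigr => i _; rewrite mul_mpolyC.
  rewrite (bigD1 j) //= big1 => [|i /negPf ->]; last by rewrite scale0r mulr0.
  by rewrite eqxx scale1r addr0 mul_mpolyC scalerA divff // scale1r subrr.
have sdiv p : divides F (p - sigma p).
  apply: (mpoly_congr (f := idfun) (g := sigma) (I := divides F)) => [|d|i] /=.
  - split; first by exists 0; rewrite mulr0.
      by move=> x y; apply: dividesD.
    by move=> a x; apply: divides_mull.
  - by rewrite comp_mpolyC subrr; exists 0; rewrite mulr0.
  - rewrite sX opprB addrC subrK -mul_mpolyC -mul_mpolyC.
    by apply/divides_mull/divides_mull; exists 1; rewrite mulr1.
have ker p : sigma p = 0 -> divides F p.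
  by move=> sp; have := sdiv p; rewrite sp subr0.
have mulF a : sigma (F * a) = 0 by rewrite rmorphM sF mul0r.
split=> [[a e]|x y [a e]].
  by have := mulF a; rewrite -e rmorph1 => /eqP; rewrite oner_eq0.
have := mulF a; rewrite -e rmorphM => /eqP.
by rewrite mulf_eq0 => /orP[] /eqP/ker; [left|right].
Qed.

Lemma coprime_not_divides n (F H : {mpoly K[n]}) :
  linear_form F -> coprime_elts F H -> ~ divides F H.
Proof.
move=> linF cop [a e]; have [] := linear_form_prime linF; case.
have uF : F \is a GRing.unit.
  by apply: cop; [exists 1; rewrite mul1r | exists a; rewrite mulrC].
by exists F^-1; rewrite divrr.
Qed.

Lemma mwiden_divides n (F H : {mpoly K[n]}) :
  divides (mwiden F) (mwiden H) -> divides F H.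
Proof.
move=> [a e]; exists (muni a)`_0.
have := congr1 (@muni n K) e; rewrite rmorphM /= !muni_mwiden => e'.
by have := congr1 (fun r : {poly _} => r`_0) e'; rewrite /= coefC eqxx coefCM.
Qed.

Lemma plane_linear_form (F : {mpoly K[2]}) : linear_form F ->
  exists j : 'I_2, forall H, linear_form H ->
    exists a b : K, H = a *: F + b *: 'X_j.
Proof.
move=> linF; have [i ci0] := linear_form_coef linF.
pose j := rev_ord i; exists j => H linH.
have two (T : {mpoly K[2]}) : linear_form T ->
    T = T@_(U_(i)) *: 'X_i + T@_(U_(j)) *: 'X_j.
  move=> /linear_form_sum {1}->; rewrite (bigD1 i) //= (bigD1 j) /=; last first.
    by rewrite /j; case: i {ci0 j} => -[|[|]].
  rewrite big1 ?addr0 // => k /andP[].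
  by rewrite /j; case: i {ci0 j} k => -[|[|]] // ? [[|[|]]].
exists (H@_(U_(i)) / F@_(U_(i))), (H@_(U_(j)) - H@_(U_(i)) / F@_(U_(i)) *
  F@_(U_(j))).
rewrite {1}(two _ linH) [X in _ = _ *: X + _](two _ linF) scalerDr !scalerA
  divfK //.
by rewrite scalerBl -addrA [X in _ = _ + X]addrCA subrr addr0.
Qed.

End LinearForms.

Section Products.
Variables (A : idomainType) (h : nat) (F : 'I_h -> A).
Hypothesis prF : forall i, prime_elt (F i).
Hypothesis copF : forall i j, i != j -> ~ divides (F i) (F j).

Lemma prime_divides_prod (s : seq 'I_h) i :
  divides (F i) (\prod_(j <- s) F j) -> i \in s.
Proof.
elim: s => [|j s IH]; first by rewrite big_nil; case: (prF i).
rewrite big_cons inE => /(proj2 (prF i)) [|/IH ->]; last by rewrite orbT.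
by have [//|/copF] := eqVneq i j.
Qed.

Lemma prod_primes_divides e :
  (forall i, divides (F i) e) -> divides (\prod_i F i) e.
Proof.
move=> Fe; suff: forall s : seq 'I_h, uniq s -> divides (\prod_(i <- s) F i) e.
  by apply; apply: index_enum_uniq.
elim=> [|i s IH]; first by exists e; rewrite big_nil mul1r.
rewrite cons_uniq big_cons => /andP[nis /IH [a ea]].
have := Fe i; rewrite ea => /(proj2 (prF i)) [/prime_divides_prod|[b ->]].
  by rewrite (negPf nis).
by exists b; ring.
Qed.

Lemma prod_primes_radical e n :
  divides (\prod_i F i) (e ^+ n) -> divides (\prod_i F i) e.
Proof.
move=> Fe; apply: prod_primes_divides => i.
have : divides (F i) (e ^+ n).
  by apply: divides_trans Fe; rewrite (bigD1 i) //=; eexists.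
elim: n {Fe} => [|n IH]; first by case: (prF i).
by rewrite exprS => /(proj2 (prF i)) [].
Qed.

End Products.

(** * The grading of the polynomial ring *)

Section Grading.
Variables (K : fieldType) (n : nat).
Local Notation S := {mpoly K[n]}.

(** The degree [d] part of [p] is the coefficient of ['X^d] in [grade p], so
    that [p] has order at least [d] when ['X^d] divides [grade p]. *)
Definition grade : S -> {poly S} :=
  mmap (polyC \o @mpolyC n K) (fun i => 'X_i *: 'X).

HB.instance Definition _ := GRing.RMorphism.on grade.

Lemma gradeB p q : grade (p - q) = grade p - grade q.
Proof. exact: rmorphB. Qed.

Lemma gradeM p q : grade (p * q) = grade p * grade q.
Proof. exact: rmorphM. Qed.

Lemma gradeXn p k : grade (p ^+ k) = grade p ^+ k.
Proof. exact: rmorphXn. Qed.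

Lemma gradeC c : grade c%:MP = c%:MP%:P.
Proof. by rewrite /grade mmapC. Qed.

Lemma gradeXU i : grade 'X_i = 'X_i *: 'X.
Proof. by rewrite /grade mmapX mmap1U. Qed.

Lemma gradeX u : grade 'X_[u] = 'X_[u] *: 'X^(mdeg u).
Proof.
rewrite {1}mpolyXE_id rmorph_prod /=.
under eq_bigr => i _ do rewrite rmorphXn /= gradeXU exprZn.
by rewrite scaler_prod prodrXr -mdegE -mpolyXE_id.
Qed.

Lemma gradeE p d : (grade p)`_d = \sum_(u <- msupp p | mdeg u == d) p@_u *: 'X_[u].
Proof.
rewrite {1}(mpolyE p) rmorph_sum coef_sum [RHS]big_mkcond /=; apply: eq_bigr => u _.
rewrite -mul_mpolyC rmorphM /= gradeC gradeX coefCM coefZ coefXn eq_sym.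
by case: eqP => _; rewrite ?mulr1 ?mulr0 ?mul0r // mul_mpolyC.
Qed.

Lemma grade_homog p d : grade (grade p)`_d = (grade p)`_d *: 'X^d.
Proof.
rewrite gradeE rmorph_sum scaler_suml; apply: eq_bigr => u /eqP du.
by rewrite -mul_mpolyC rmorphM /= gradeC gradeX du mul_polyC scalerA mul_mpolyC.
Qed.

Lemma grade_sum p : p = \sum_(d < size (grade p)) (grade p)`_d.
Proof.
have : (grade p).[1] = p.
  apply: (mpoly_ext (f := horner_eval 1 \o grade) (g := idfun)) => [c|i] /=.
    by rewrite gradeC /horner_eval hornerC.
  by rewrite gradeXU /horner_eval hornerZ hornerX mulr1.
rewrite horner_coef => {1}<-; apply: eq_bigr => i _.
by rewrite expr1n mulr1.
Qed.

Lemma grade0 p : (grade p)`_0 = (p@_0%MM)%:MP.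
Proof.
rewrite -horner_coef0.
apply: (mpoly_ext (f := horner_eval 0 \o grade)
  (g := @mpolyC n K \o mcoeff 0%MM)) => [c|i] /=.
  by rewrite gradeC /horner_eval hornerC mcoeffC eqxx mulr1.
by rewrite gradeXU /horner_eval hornerZ hornerX mulr0 mcoeffX mnm1_eq0 mpolyC0.
Qed.

Definition order_ge (d : nat) (p : S) : Prop := divides 'X^d (grade p).

Lemma order_ge_coef d p i : order_ge d p -> (i < d)%N -> (grade p)`_i = 0.
Proof. by move=> [a ->] id; rewrite coefXnM id. Qed.

Lemma order_ge1 p : p@_0%MM = 0 -> order_ge 1 p.
Proof.
move=> p0; have : root (grade p) 0 by rewrite /root horner_coef0 grade0 p0 mpolyC0.
by move=> /factor_theorem [a ea]; exists a; rewrite ea subr0 expr1 mulrC.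
Qed.

Lemma order_geM d e p q :
  order_ge d p -> order_ge e q -> order_ge (d + e) (p * q).
Proof.
by move=> [a ea] [b eb]; exists (a * b); rewrite rmorphM /= ea eb exprD; ring.
Qed.

Lemma order_geD d p q : order_ge d p -> order_ge d q -> order_ge d (p + q).
Proof. by move=> op oq; rewrite /order_ge rmorphD; exact: (dividesD op oq). Qed.

Lemma order_ge_mull d p q : order_ge d q -> order_ge d (p * q).
Proof. by move=> oq; rewrite /order_ge rmorphM; exact: (divides_mull _ oq). Qed.

Lemma order_ge_0 d : order_ge d 0.
Proof. by exists 0; rewrite rmorph0 mulr0. Qed.

Lemma linear_form_grade F : linear_form F -> grade F = F *: 'X.
Proof.
move=> linF; rewrite (linear_form_sum linF) rmorph_sum scaler_suml /=.
by apply: eq_bigr => i _; rewrite -mul_mpolyC rmorphM /= gradeC gradeXU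
  mul_polyC scalerA.
Qed.

End Grading.

(** * The local ring of the surface at the origin *)

Section Surface.
Variables (K : fieldType) (m h : nat) (F : 'I_h -> {mpoly K[2]}).
Hypotheses (h_gt0 : (0 < h)%N) (h_lt_m : (h < m)%N).
Hypothesis F_linear : forall i : 'I_h, linear_form (F i).
Hypothesis F_coprime : forall i j : 'I_h, i != j -> coprime_elts (F i) (F j).

Local Notation A0 := {mpoly K[2]}.
Local Notation S := {mpoly K[3]}.
Let f0 : A0 := \prod_i F i.
Let f : S := \prod_i mwiden (F i).
Let G : S := surface_poly m F.
Let Z : S := 'X_ord_max.
Let m_gt0 : (0 < m)%N. Proof. exact: leq_ltn_trans h_lt_m. Qed.

Let F_prime i : prime_elt (F i). Proof. exact: linear_form_prime. Qed.

Let F_ndiv i j : i != j -> ~ divides (F i) (F j).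
Proof. by move=> ij; apply: coprime_not_divides => //; apply: F_coprime. Qed.

Lemma curve_neq0 : f0 != 0.
Proof. by apply/prodf_neq0 => i _; case: (F_linear i). Qed.

Lemma curve_radical e n : divides f0 (e ^+ n) -> divides f0 e.
Proof. exact: prod_primes_radical. Qed.

Lemma curve_mwiden : mwiden f0 = f.
Proof. by rewrite rmorph_prod. Qed.

Lemma curve_radical3 (e : S) n : divides f (e ^+ n) -> divides f e.
Proof.
apply: prod_primes_radical => [i|i j ij /mwiden_divides].
  exact/linear_form_prime/linear_form_mwiden.
exact: F_ndiv.
Qed.

Lemma muni_surface : muni G = 'X^m - f0%:P.
Proof.
by rewrite /G /surface_poly rmorphB rmorphXn /= muniX_max -/f -curve_mwiden
  muni_mwiden.
Qed.

Lemma muni_divides (p q : S) : divides p q <-> divides (muni p) (muni q).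
Proof.
split=> -[a e]; first by exists (muni a); rewrite e rmorphM.
exists (mpoly_of_poly a); apply: (can_inj (@muniK K 2)).
by rewrite rmorphM /= mpoly_of_polyK.
Qed.

(** Eisenstein applies at any form [F i0], as it divides no other form. *)
Lemma surface_prime : prime_elt G.
Proof.
pose i0 := Ordinal h_gt0.
have prX : prime_elt ('X^m - f0%:P).
  apply: (@eisenstein_prime _ (F i0) f0 (\prod_(i | i != i0) F i)) => //.
  - exact: mpoly_completely_closed.
  - by case: (F_linear i0).
  - by rewrite /f0 (bigD1 i0).
  rewrite -big_filter => /(prime_divides_prod F_prime F_ndiv).
  by rewrite mem_filter eqxx.
split=> [/muni_divides|p q /muni_divides].
  by rewrite muni_surface rmorph1 => /(proj1 prX).
by rewrite muni_surface rmorphM => /(proj2 prX) [] H; [left|right];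
  apply/muni_divides; rewrite muni_surface.
Qed.

Lemma surface_neq0 : G != 0.
Proof.
rewrite -(raddf_eq0 _ (can_inj (@muniK K 2))) /= muni_surface.
by apply/monic_neq0/monicXnsubC.
Qed.

Lemma surface_irreducible : irreducible_elt G.
Proof.
have [nG1 prG] := surface_prime.
split; first exact: surface_neq0.
  by apply/negP => uG; apply: nG1; exists G^-1; rewrite divrr.
have unit_cofactor a b c : G = a * b -> a = G * c -> b \is a GRing.unit.
  move=> eG ea; have e1 : c * b = 1.
    by apply: (mulfI surface_neq0); rewrite mulrA -ea -eG mulr1.
  by apply/unitrP; exists c; split=> //; rewrite mulrC.
move=> a b eG; have : divides G (a * b) by rewrite -eG; exists 1; rewrite mulr1.
case/prG => -[c ec]; [right|left].
  exact: unit_cofactor ec.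
by apply: unit_cofactor ec; rewrite mulrC.
Qed.

Variables (B : comNzRingType) (q : {rmorphism S -> B}).
Hypothesis B_quotient : is_quotient q (ideal_gen [set G]).
Variables (R : comUnitRingType) (loc : {rmorphism B -> R}).
Let PB : set B := ideal_gen (range (fun i : 'I_3 => q 'X_i)).
Hypothesis R_localization : is_localization_at loc PB.

Let theta : {rmorphism S -> R} := loc \o q.
Let ev0 (p : S) : K := p@_0%MM.

Lemma ev0M p r : ev0 (p * r) = ev0 p * ev0 r.
Proof. by rewrite /ev0 rmorphM. Qed.

Lemma ev0D p r : ev0 (p + r) = ev0 p + ev0 r.
Proof. by rewrite /ev0 raddfD. Qed.

Lemma ev0_surface : ev0 G = 0.
Proof.
rewrite /G /surface_poly /ev0 rmorphB rmorphXn rmorph_prod /=.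
rewrite mcoeffX mnm1_eq0 -(prednK m_gt0) expr0n /= (bigD1 (Ordinal h_gt0)) //=.
have [_ homF] := linear_form_mwiden (F_linear (Ordinal h_gt0)).
have -> : (mwiden (F (Ordinal h_gt0)))@_0%MM = 0.
  by apply: (dhomog_nemf_coeff homF); rewrite /= mdeg0.
by rewrite mul0r subrr.
Qed.

Lemma quotient_eq0 (p : S) : q p = 0 <-> divides G p.
Proof.
case: B_quotient => _ /(_ p) ->; split.
  apply: ideal_gen_min => [|_ ->]; last by exists 1; rewrite mulr1.
  split; first by exists 0; rewrite mulr0.
    by move=> x y; apply: dividesD.
  by move=> a x; apply: divides_mull.
by move=> [a ->]; rewrite mulrC; apply: lin_span_term.
Qed.

Lemma ideal_vars (I : set R) p : is_ideal I -> (forall i, I (theta 'X_i)) ->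
  ev0 p = 0 -> I (theta p).
Proof.
move=> [I0 ID IM] IX p0.
have idJ : is_ideal [set p | I (theta p)].
  split=> /= [|x y Ix Iy|a x Ix]; first by rewrite !rmorph0.
    by rewrite !rmorphD; apply: ID.
  by rewrite !rmorphM; apply: IM.
have /= := mpoly_congr (f := idfun) (g := @mpolyC 3 K \o mcoeff 0%MM) idJ _ _ p.
rewrite -/(ev0 p) p0 mpolyC0 subr0; apply => [c|i] /=.
  by rewrite mcoeffC eqxx mulr1 subrr !rmorph0.
by rewrite mcoeffX mnm1_eq0 mpolyC0 subr0; apply: IX.
Qed.

Lemma origin_ideal p : PB (q p) <-> ev0 p = 0.
Proof.
split=> [Pp|p0].
  have [p' [ep p'0]] : exists p', q p' = q p /\ ev0 p' = 0.
    move: (q p) Pp; apply: ideal_gen_min => [|_ [i _ <-]]; last first.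
      by exists 'X_i; rewrite /ev0 mcoeffX mnm1_eq0.
    split; first by exists 0; rewrite rmorph0 /ev0 mcoeff0.
      move=> _ _ [x [<- x0]] [y [<- y0]]; exists (x + y).
      by rewrite rmorphD ev0D x0 y0 addr0.
    move=> a _ [x [<- x0]]; have [b eb] := proj1 B_quotient a.
    by exists (b * x); rewrite rmorphM eb ev0M x0 mulr0.
  have /quotient_eq0 [a ea] : q (p - p') = 0 by rewrite rmorphB ep subrr.
  by rewrite -(subrK p' p) ev0D p'0 ea ev0M ev0_surface mul0r addr0.
have idP := ideal_gen_ideal (range (fun i : 'I_3 => q 'X_i)).
have [P0 PD PM] := idP.
have idJ : is_ideal [set p | PB (q p)].
  split=> /= [|x y Ix Iy|a x Ix]; first by rewrite rmorph0.
    by rewrite rmorphD; apply: PD.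
  by rewrite rmorphM; apply: PM.
have /= := mpoly_congr (f := idfun) (g := @mpolyC 3 K \o mcoeff 0%MM) idJ _ _ p.
rewrite -/(ev0 p) p0 mpolyC0 subr0; apply => [c|i] /=.
  by rewrite mcoeffC eqxx mulr1 subrr rmorph0.
by rewrite mcoeffX mnm1_eq0 mpolyC0 subr0; apply: sub_ideal_gen; exists i.
Qed.

Lemma theta_eq0 (p : S) : theta p = 0 <-> divides G p.
Proof.
have [_ _ H0] := R_localization; split.
  move=> /H0 [s [nPs sp]].
  have [s' es] := proj1 B_quotient s; rewrite -es in nPs sp.
  have /quotient_eq0 : q (s' * p) = 0 by rewrite rmorphM.
  case/(proj2 surface_prime) => // -[a ea]; case: nPs.
  by apply/origin_ideal; rewrite ea ev0M ev0_surface mul0r.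
by move/quotient_eq0 => e; rewrite /theta /= e rmorph0.
Qed.

Lemma theta_frac r : exists a s, ev0 s != 0 /\ r = theta a / theta s.
Proof.
have [_ H _] := R_localization; have [b [s [nPs ->]]] := H r.
have [a ea] := proj1 B_quotient b; have [t et] := proj1 B_quotient s.
exists a, t; rewrite /theta /= ea et; split=> //.
by apply/eqP => t0; apply: nPs; rewrite -et; apply/origin_ideal.
Qed.

Lemma theta_unit p : (theta p \is a GRing.unit) = (ev0 p != 0).
Proof.
have [H _ _] := R_localization; apply/idP/idP => [up|p0]; last first.
  by apply: H => /origin_ideal /eqP; apply/negP.
apply/eqP => p0; have [a [s [s0 e]]] := theta_frac (theta p)^-1.
have us : theta s \is a GRing.unit.
  by apply: H => /origin_ideal /eqP; apply/negP.
have : theta (p * a - s) = 0.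
  rewrite rmorphB rmorphM.
  have -> : theta a = (theta p)^-1 * theta s by rewrite e mulrVK.
  by rewrite mulrA divrr // mul1r subrr.
move=> /theta_eq0 [c ec]; move/eqP: s0; apply.
have -> : s = p * a - G * c by rewrite -ec; ring.
by rewrite -mulN1r ev0D !ev0M p0 ev0_surface; ring.
Qed.

Lemma theta_inj (p r : S) : theta p = theta r <-> divides G (p - r).
Proof.
by rewrite -theta_eq0 rmorphB; split=> [->|/eqP];
  rewrite ?subrr // subr_eq0 => /eqP.
Qed.

Lemma local_domain : GRing.integral_domain_axiom R.
Proof.
move=> x y; have [a [s [s0 ->]]] := theta_frac x.
have [b [t [t0 ->]]] := theta_frac y.
have us : theta s \is a GRing.unit by rewrite theta_unit.
have ut : theta t \is a GRing.unit by rewrite theta_unit.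
move=> /(congr1 (fun u => u * (theta s * theta t))); rewrite mul0r.
have -> : theta a / theta s * (theta b / theta t) * (theta s * theta t) =
    (theta a / theta s * theta s) * (theta b / theta t * theta t) by ring.
rewrite !mulrVK // -rmorphM => /theta_eq0 /(proj2 surface_prime).
by case=> /theta_eq0 ->; rewrite mul0r eqxx ?orbT.
Qed.

(** The nonunits; [theta_unit] identifies them as the fractions whose numerator
    vanishes at the origin. *)
Definition max_ideal : set R := [set r | r \isn't a GRing.unit].

Lemma max_ideal_frac a s : ev0 s != 0 ->
  max_ideal (theta a / theta s) <-> ev0 a = 0.
Proof.
move=> s0; have us : theta s \is a GRing.unit by rewrite theta_unit.
rewrite /max_ideal /= unitrMl ?unitrV // theta_unit.
by split=> [/negP/negP/negPn/eqP|->] //; rewrite eqxx.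
Qed.

Lemma frac_addE a s b t c : ev0 s != 0 -> ev0 t != 0 ->
  theta c * (theta a / theta s) + theta b / theta t =
  theta (c * a * t + b * s) / theta (s * t).
Proof.
move=> s0 t0; have us : theta s \is a GRing.unit by rewrite theta_unit.
have ut : theta t \is a GRing.unit by rewrite theta_unit.
have ust : theta (s * t) \is a GRing.unit by rewrite rmorphM unitrMl.
apply: (mulIr ust); rewrite mulrVK // rmorphD !rmorphM mulrDl.
have -> : theta c * (theta a / theta s) * (theta s * theta t) =
  theta c * (theta a / theta s * theta s) * theta t by ring.
have -> : theta b / theta t * (theta s * theta t) =
  theta b / theta t * theta t * theta s by ring.
by rewrite !mulrVK.
Qed.

Lemma max_ideal_is_ideal : is_ideal max_ideal.
Proof.
split; first by rewrite /max_ideal /= unitr0.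
  move=> x y; have [a [s [s0 ->]]] := theta_frac x.
  have [b [t [t0 ->]]] := theta_frac y.
  move=> /(max_ideal_frac _ s0) a0 /(max_ideal_frac _ t0) b0.
  have := frac_addE a b 1 s0 t0; rewrite rmorph1 !mul1r => ->.
  by apply/max_ideal_frac; rewrite ?ev0D !ev0M ?mulf_neq0 // a0 b0 !mul0r addr0.
by move=> a x; rewrite /max_ideal /= unitrM negb_and => ->; rewrite orbT.
Qed.

Lemma max_idealP (J : set R) : idealr_closed (mem J) -> J `<=` max_ideal.
Proof.
case=> J0 J1 JD x Jx; apply/negP => ux; move/negP: J1; apply.
by have := JD x^-1 x 0 (mem_set Jx) J0; rewrite mulVr // addr0.
Qed.

Lemma max_ideal_maximal : maximal_ideal max_ideal.
Proof.
have [I0 ID IM] := max_ideal_is_ideal; split.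
  split; first exact: mem_set.
    by apply/negP => /set_mem; rewrite /max_ideal /= unitr1.
  by move=> a x y /set_mem Ix /set_mem Iy; apply/mem_set/ID => //; apply: IM.
by move=> J /max_idealP JM MJ; apply/seteqP; split.
Qed.

Lemma maximal_unique (M : set R) : maximal_ideal M -> M = max_ideal.
Proof.
case=> cM maxM; symmetry; apply: maxM; last exact: max_idealP.
by case: max_ideal_maximal.
Qed.

Lemma surface_local : local_ring R.
Proof.
exists max_ideal; split; first exact: max_ideal_maximal.
by move=> M /maximal_unique.
Qed.

(** The degree [d] part of a polynomial is a combination of monomials, which lie
    in the [d]-th power of the maximal ideal. *)
Lemma max_idealX n r : idealX max_ideal n r <->
  exists a s, [/\ order_ge n a, ev0 s != 0 & r = theta a / theta s].
Proof.
split; last first.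
  move=> [a [s [oa s0 ->]]]; apply: ideal_mulr; first exact: idealX_ideal.
  have part d (b : S) : idealX max_ideal d (theta (grade b)`_d).
    rewrite gradeE rmorph_sum; apply: ideal_sum => [|u /eqP <-];
      first exact: idealX_ideal.
    rewrite -mul_mpolyC rmorphM; have [_ _ IM] := idealX_ideal max_ideal (mdeg u).
    apply: IM; rewrite mpolyXE_id rmorph_prod mdegE.
    apply: (big_ind2 (fun x k => idealX max_ideal k x)) => //.
      by move=> x1 k1 x2 k2; apply: idealX_mul.
    move=> i _; rewrite rmorphXn; apply: idealX_exp.
    by rewrite /max_ideal /= theta_unit /ev0 mcoeffX mnm1_eq0 eqxx.
  rewrite (grade_sum a) rmorph_sum; apply: ideal_sum => [|d _];
    first exact: idealX_ideal.
  have [nd|dn] := leqP n d; first by apply: (idealX_le nd).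
  by rewrite (order_ge_coef oa dn) rmorph0; case: (idealX_ideal max_ideal n).
pose I n := [set r | exists a s, [/\ order_ge n a, ev0 s != 0 & r = theta a /
  theta s]].
have idI k : is_ideal (I k).
  split.
  - exists 0, 1; rewrite rmorph0 mul0r /ev0 mcoeff1 eqxx oner_eq0.
    by split=> //; apply: order_ge_0.
  - move=> _ _ [a [s [oa s0 ->]]] [b [t [ob t0 ->]]].
    have := frac_addE a b 1 s0 t0; rewrite rmorph1 !mul1r => ->.
    exists (a * t + b * s), (s * t); split; last reflexivity.
      by apply: order_geD; rewrite mulrC; apply: order_ge_mull.
    by rewrite ev0M mulf_neq0.
  - move=> x _ [a [s [oa s0 ->]]]; have [b [t [t0 ->]]] := theta_frac x.
    exists (b * a), (t * s); split; last 1 first.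
    + by rewrite !rmorphM invrM ?theta_unit //; ring.
    + exact: order_ge_mull.
    + by rewrite ev0M mulf_neq0.
suff: idealX max_ideal n `<=` I n by apply.
elim: n {r} => [r _|n IH].
  by have [a [s [s0 ->]]] := theta_frac r; exists a, s; split=> //;
    exists (grade a); rewrite mul1r.
apply: idealM_min => // x y Mx /IH [b [t [ob t0 ->]]].
have [a [s [s0 ex]]] := theta_frac x; rewrite ex in Mx *.
move/(max_ideal_frac _ s0): Mx => a0.
exists (a * b), (s * t); split; last 1 first.
- by rewrite !rmorphM invrM ?theta_unit //; ring.
- exact: (order_geM (order_ge1 a0) ob).
- by rewrite ev0M mulf_neq0.
Qed.

Lemma grade_curve : grade f = f *: 'X^h.
Proof.
rewrite /f rmorph_prod /=.
under eq_bigr => i _ do rewrite (linear_form_grade (linear_form_mwiden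
  (F_linear i))).
by rewrite scaler_prod prodr_const card_ord.
Qed.

Lemma grade_surface : grade G = 'X^h * ('X^(m - h) * (Z ^+ m)%:P - f%:P).
Proof.
have -> : G = Z ^+ m - f by [].
rewrite gradeB gradeXn gradeXU exprZn grade_curve.
rewrite mulrBr mulrA -exprD subnKC ?(ltnW h_lt_m) //.
by rewrite -!mul_polyC [_%:P * _]mulrC [_%:P * 'X^h]mulrC.
Qed.

(** The tangent cone [f = 0] is reduced: if the initial form of [r ^+ n]
    vanishes on it, so does that of [r], which a multiple of [G] then cancels. *)
Lemma reduced_cone d n r : (0 < n)%N -> idealX max_ideal d r ->
  idealX max_ideal (d * n).+1 (r ^+ n) -> idealX max_ideal d.+1 r.
Proof.
move=> n_gt0 /max_idealX [P [s [[P' eP] s0 er]]].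
move=> /max_idealX [W [t [[W' eW] t0 ern]]].
set g : {poly S} := 'X^(m - h) * (Z ^+ m)%:P - f%:P.
have eG : grade G = 'X^h * g := grade_surface.
have g0 : g`_0 = - f.
  by rewrite /g coefB coefXnM subn_gt0 h_lt_m sub0r coefC.
have us : theta s \is a GRing.unit by rewrite theta_unit.
have ut : theta t \is a GRing.unit by rewrite theta_unit.
have [H eH] : divides G (t * P ^+ n - s ^+ n * W).
  apply/theta_inj; rewrite !rmorphM !rmorphXn.
  have -> : theta P = r * theta s by rewrite er mulrVK.
  have -> : theta W = r ^+ n * theta t by rewrite ern mulrVK.
  by rewrite exprMn; ring.
set Y : {poly S} := grade t * P' ^+ n - 'X * (grade s ^+ n * W').
have eY : 'X^(d * n) * Y = 'X^h * (g * grade H).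
  have e : grade (t * P ^+ n - s ^+ n * W) = grade G * grade H.
    by rewrite eH gradeM.
  rewrite eG gradeB !gradeM !gradeXn eP eW in e.
  by rewrite mulrA -e /Y exprMn -exprM exprS; ring.
have Y0 : Y`_0 = (ev0 t)%:MP * P'`_0 ^+ n.
  by rewrite coefB coefXM subr0 coef0M grade0 -!horner_coef0 horner_exp.
have X0 k : ('X^k : {poly S}) != 0 by rewrite expf_neq0 // polyX_eq0.
have fn0 : f != 0 by rewrite -curve_mwiden (raddf_eq0 _ (@inj_mwiden 2 K))
  curve_neq0.
have g0' : g`_0 != 0 by rewrite g0 oppr_eq0.
have fP : divides f P'`_0.
  apply: (@curve_radical3 _ n).
  suff [c ec] : divides f Y`_0.
    exists ((ev0 t)^-1%:MP * c); rewrite mulrCA -ec Y0 mulrA -mpolyCM mulVf //.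
    by rewrite mpolyC1 mul1r.
  have [hd|dh] := leqP h (d * n); last first.
    exists 0; rewrite mulr0.
    have -> : Y = 'X^(h - d * n) * (g * grade H).
      by apply: (mulfI (X0 (d * n)%N)); rewrite eY [RHS]mulrA -exprD subnKC // ltnW.
    by rewrite coefXnM subn_gt0 dh.
  have eY' : 'X^(d * n - h) * Y = g * grade H.
    by apply: (mulfI (X0 h)); rewrite -eY mulrA -exprD subnKC.
  have [|H' eH'] := @divides_Xn_reg _ (d * n - h) g (grade H) g0'.
    by exists Y.
  exists (- H'`_0).
  have -> : Y = g * H'.
    by apply: (mulfI (X0 (d * n - h)%N)); rewrite eY' eH'; ring.
  by rewrite coef0M g0; ring.
have [C eC] := fP.
have gC : 'X^h * grade C = C *: 'X^d.
  have ePd : P'`_0 = (grade P)`_d by rewrite eP coefXnM ltnn subnn.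
  have := grade_homog P d; rewrite -ePd eC gradeM grade_curve => e.
  have f0C : f%:P != 0 by rewrite polyC_eq0.
  by apply: (mulfI f0C); rewrite [RHS]mul_polyC scalerA -e -mul_polyC; ring.
have theta_low Q : theta Q = theta P -> order_ge d.+1 Q -> idealX max_ideal d.+1 r.
  by move=> eQ oQ; apply/max_idealX; exists Q, s; rewrite er eQ.
have lowX (Q : {poly S}) : Q`_0 = 0 -> divides 'X^(d.+1) ('X^d * Q).
  rewrite -horner_coef0 => /eqP/factor_theorem [a ->].
  by exists a; rewrite subr0 exprSr; ring.
have [hd|dh] := leqP h d; last first.
  apply: (theta_low P) => //; rewrite /order_ge eP; apply: lowX.
  rewrite eC; suff -> : C = 0 by rewrite mulr0.
  have := congr1 (fun r : {poly S} => r`_d) gC.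
  by rewrite coefXnM dh coefZ coefXn eqxx mulr1.
apply: (theta_low (P + G * C)).
  by apply/theta_inj; exists C; ring.
have gC' : grade C = C *: 'X^(d - h).
  by apply: (mulfI (X0 h)); rewrite gC -!mul_polyC mulrCA -exprD subnKC.
rewrite /order_ge rmorphD rmorphM /= eG eP gC'.
have -> : 'X^d * P' + 'X^h * g * (C *: 'X^(d - h)) = 'X^d * (P' + g * C%:P).
  have eXd : 'X^d = 'X^h * 'X^(d - h) :> {poly S} by rewrite -exprD subnKC.
  by rewrite eXd -mul_polyC; ring.
apply: lowX; rewrite coefD coef0M coefC eqxx g0 eC; ring.
Qed.

Lemma theta_common_denominator (P : {poly R}) : exists s, ev0 s != 0 /\
  forall i, exists a, P`_i * theta s = theta a.
Proof.
suff: forall n, exists s, ev0 s != 0 /\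
    forall i, (i < n)%N -> exists a, P`_i * theta s = theta a.
  move=> /(_ (size P)) [s [s0 Hs]]; exists s; split=> // i.
  have [/Hs //|Pi] := ltnP i (size P).
  by exists 0; rewrite nth_default // mul0r rmorph0.
elim=> [|n [s [s0 Hs]]]; first by exists 1; rewrite /ev0 mcoeff1 eqxx oner_eq0.
have [a [t [t0 ePn]]] := theta_frac P`_n.
have ut : theta t \is a GRing.unit by rewrite theta_unit.
exists (s * t); split; first by rewrite ev0M mulf_neq0.
move=> i; rewrite ltnS leq_eqVlt => /orP[/eqP ->|/Hs [b eb]].
  by exists (s * a); rewrite !rmorphM mulrCA ePn mulrVK.
by exists (b * t); rewrite !rmorphM mulrA eb.
Qed.

Section Normality.
Variables (L : fieldType) (iota : {rmorphism R -> L}).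
Hypothesis L_fractions : is_quotient_field iota.

Let lambda : {rmorphism S -> L} := iota \o theta.
Let kappa : {rmorphism A0 -> L} := lambda \o @mwiden 2 K.
Let z : L := lambda Z.

Lemma lambda_eq0 p : lambda p = 0 -> divides G p.
Proof. by rewrite -(rmorph0 iota) => /(proj1 L_fractions)/theta_eq0. Qed.

Lemma lambda_poly (r : {poly A0}) :
  lambda (mpoly_of_poly r) = (map_poly kappa r).[z].
Proof.
have -> : mpoly_of_poly r = (map_poly (@mwiden 2 K) r).[Z] by [].
by rewrite -(horner_map lambda) -map_poly_comp.
Qed.

Lemma lambda_muni p : lambda p = (map_poly kappa (muni p)).[z].
Proof. by rewrite -lambda_poly muniK. Qed.

Lemma z_exp : z ^+ m = kappa f0.
Proof.
apply/eqP; rewrite -subr_eq0 -rmorphXn; apply/eqP.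
have -> : kappa f0 = lambda f by rewrite -curve_mwiden.
rewrite -rmorphB; have /theta_eq0 e : divides G (Z ^+ m - f).
  by exists 1; rewrite mulr1.
by rewrite -[lambda _]/(iota (theta _)) e rmorph0.
Qed.

Lemma free_powers (r : {poly A0}) :
  (size r <= m)%N -> (map_poly kappa r).[z] = 0 -> r = 0.
Proof.
move=> szr; rewrite -lambda_poly => /lambda_eq0 /muni_divides.
rewrite mpoly_of_polyK muni_surface; apply: monic_divides_small.
  exact: monicXnsubC.
by rewrite size_XnsubC // ltnS.
Qed.

Lemma kappa_inj : injective kappa.
Proof.
apply/raddf_inj => c kc; apply/eqP; rewrite -polyC_eq0; apply/eqP.
apply: free_powers; last by rewrite map_polyC hornerC.
by rewrite (leq_trans (size_polyC_leq1 _)).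
Qed.

Lemma lambda_integral p : integralOver kappa (lambda p).
Proof.
rewrite lambda_muni; apply: integral_horner.
  by apply/integral_poly => i; rewrite coef_map; apply: integral_id.
exact: integral_radical m_gt0 z_exp.
Qed.

(** An algebraic equation of [lambda v], freed of powers of the unknown, has a
    nonzero constant term, and this is a multiple of [lambda v]. *)
Lemma lambda_norm v : lambda v != 0 -> exists w d,
  d != 0 /\ lambda v * lambda w = kappa d.
Proof.
move=> v0; have [P monP] := lambda_integral v.
move/monic_neq0: monP.
have [k] := ubnP (size P); elim: k P => // k IH P; rewrite ltnS => szP P0 rootP.
have [Q [c eP]] : exists (Q : {poly A0}) c, P = Q * 'X + c%:P.
  by elim/poly_ind: P {szP P0 rootP} => [|Q c _]; [exists 0, 0;
    rewrite mul0r addr0|exists Q, c].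
have PQ : lambda v * (map_poly kappa Q).[lambda v] = - kappa c.
  move: rootP; rewrite /root eP rmorphD rmorphM /= map_polyX map_polyC /=.
  by rewrite hornerMXaddC mulrC addr_eq0 => /eqP.
have [c0|c0] := eqVneq c 0; last first.
  exists (- (map_poly (@mwiden 2 K) Q).[v]), c; split=> //.
  by rewrite rmorphN -(horner_map lambda) -map_poly_comp mulrN PQ opprK.
have Q0 : Q != 0.
  by apply: contraNneq P0 => Q0; rewrite eP Q0 c0 mul0r addr0.
apply: (IH Q) => //.
  by apply: leq_trans szP; rewrite eP c0 addr0 size_mulX.
by move/eqP: PQ; rewrite c0 rmorph0 oppr0 mulf_eq0 (negPf v0).
Qed.

Hypothesis m_char : forall c : nat, c \in [pchar K] -> ~~ (c %| m)%N.

Lemma m_unit : m%:R \is a @GRing.unit A0.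
Proof.
rewrite -(rmorph_nat (@mpolyC 2 K)); apply: rmorph_unit; rewrite unitfE.
apply/negP => m0; have [c cp] := natf0_pchar m_gt0 m0.
by have := m_char cp; rewrite (dvdn_pcharf cp) m0.
Qed.

(** A multiple [y = lambda s * x], with [s] a unit of the local ring, is integral
    over [K[X,Y]], and is therefore a polynomial in [z]. *)
Lemma integral_closed x : integralOver iota x -> exists a, x = iota a.
Proof.
move=> [P monP rootP].
have [s [s0 Ps]] := theta_common_denominator P.
have us : theta s \is a GRing.unit by rewrite theta_unit.
have ls0 : lambda s != 0 by rewrite -unitfE; apply: (rmorph_unit iota us).
set y := lambda s * x.
have inty : integralOver kappa y.
  pose N := (size P).-1; have szP : size P = N.+1.
    by rewrite prednK // size_poly_gt0 monic_neq0.
  pose p := \poly_(i < N.+1) (iota P`_i * lambda s ^+ (N - i)).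
  have pN : p`_N = 1.
    by rewrite coef_poly ltnSn subnn mulr1 -[N]/(size P).-1 -lead_coefE (eqP
      monP) rmorph1.
  have szp : size p = N.+1.
    by apply: size_poly_eq; rewrite subnn mulr1 -[N]/(size P).-1 -lead_coefE
      (eqP monP) rmorph1 oner_eq0.
  apply: (@integral_root_monic _ _ kappa y p).
  - by rewrite monicE lead_coefE szp pN.
  - rewrite /root horner_poly; apply/eqP.
    transitivity (lambda s ^+ N * (map_poly iota P).[x]); last first.
      by rewrite (eqP rootP) mulr0.
    rewrite (horner_coef_wide (n := N.+1)); last by rewrite -szP size_poly.
    rewrite big_distrr /=; apply: eq_bigr => i _; rewrite coef_map exprMn.
    have -> : lambda s ^+ N = lambda s ^+ (N - i) * lambda s ^+ i.
      by rewrite -exprD subnK // -ltnS.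
    by rewrite /=; ring.
  apply/integral_poly => i; rewrite coef_poly; case: ltnP => [|_];
    last exact: integral0.
  rewrite ltnS leq_eqVlt => /orP[/eqP ->|iN].
    by rewrite subnn mulr1 -[N]/(size P).-1 -lead_coefE (eqP monP) rmorph1;
      apply: integral1.
  have [a ea] := Ps i; rewrite -(subnSK iN) exprS mulrA.
  have -> : iota P`_i * lambda s = lambda a.
    by rewrite -[lambda s]/(iota (theta s)) -rmorphM ea.
  by rewrite -rmorphXn -rmorphM; apply: lambda_integral.
have [u [v [v0 ey]]] : exists u v, lambda v != 0 /\ y = lambda u / lambda v.
  have [a [b [b0 ex]]] := proj2 L_fractions x.
  have [a1 [a2 [a20 ea]]] := theta_frac a; have [b1 [b2 [b20 eb]]] := theta_frac b.
  have ib0 : iota b != 0 by rewrite (raddf_eq0 _ (proj1 L_fractions)).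
  have ua2 : theta a2 \is a GRing.unit by rewrite theta_unit.
  have ub2 : theta b2 \is a GRing.unit by rewrite theta_unit.
  have eb1 : lambda b1 = iota b * lambda b2.
    by rewrite -[lambda b2]/(iota (theta b2)) -rmorphM eb mulrVK.
  have ea1 : lambda a1 = iota a * lambda a2.
    by rewrite -[lambda a2]/(iota (theta a2)) -rmorphM ea mulrVK.
  have lb2 : lambda b2 != 0 by rewrite -unitfE; apply: (rmorph_unit iota ub2).
  have la2 : lambda a2 != 0 by rewrite -unitfE; apply: (rmorph_unit iota ua2).
  exists (s * a1 * b2), (b1 * a2); rewrite !(rmorphM lambda) eb1 ea1 !mulf_neq0 //.
  split=> //; rewrite /y ex; by field; rewrite ib0 lb2 la2.
have [w [d [d0 vw]]] := lambda_norm v0.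
have mon : ('X^m - f0%:P : {poly A0}) \is monic by apply: monicXnsubC.
have [Q [r [er szr]]] := monic_division mon (muni (u * w)).
rewrite size_XnsubC // ltnS in szr.
have kd0 : kappa d != 0 by rewrite (raddf_eq0 _ kappa_inj).
have ey' : y = (map_poly kappa r).[z] / kappa d.
  have -> : (map_poly kappa r).[z] = lambda (u * w).
    rewrite lambda_muni er rmorphD rmorphM hornerD hornerM rmorphB /=.
    rewrite map_polyXn map_polyC hornerD hornerN hornerXn hornerC z_exp.
    by rewrite subrr mul0r add0r.
  apply: (mulIf kd0); rewrite mulfVK // -vw ey rmorphM.
  by field.
have [r' er'] : divides d%:P r.
  have inty' := inty; rewrite ey' in inty'.
  exact: (integral_kummer (mpoly_completely_closed (K:=K) (n:=2)) kappa_inj m_unit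
    curve_neq0 curve_radical z_exp free_powers d0 szr inty').
exists (theta (mpoly_of_poly r') / theta s).
rewrite rmorph_div // -[iota (theta s)]/(lambda s).
rewrite -[iota _]/(lambda (mpoly_of_poly r')) lambda_poly.
have <- : y = (map_poly kappa r').[z].
  by rewrite ey' er' rmorphM hornerM /= map_polyC hornerC mulrAC divff // mul1r.
by rewrite /y mulrAC divff // mul1r.
Qed.

End Normality.

Hypothesis m_char : forall c : nat, c \in [pchar K] -> ~~ (c %| m)%N.

Lemma surface_normal : normal_domain R.
Proof.
split=> [|L iota fracL x intx]; first exact: local_domain.
exact: (@integral_closed L iota).
Qed.

Section Completeness.
Variables (L : fieldType) (iota : {rmorphism R -> L}).
Hypothesis L_fractions : is_quotient_field iota.

(** The criterion of integral dependence gives [x ^+ N] as a sum of terms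
    [a i * x ^+ (N - i)] with [a i] in the [p * i]-th power of the maximal ideal.
    So [x] is in [R] by normality; if it lies in the [d]-th power, with [d < p],
    its [N]-th power lies in that of exponent [d * N + 1], and [reduced_cone]
    raises [d]. *)
Lemma max_idealX_complete p x :
  completion iota (idealX max_ideal p) x -> (iota @` idealX max_ideal p) x.
Proof.
have idMp := idealX_ideal max_ideal p.
have [->|x0] := eqVneq x 0; first by case: idMp => I0 _ _; exists 0;
  rewrite ?rmorph0.
move=> /(completion_integral idMp x0) [P [P0 PJ Px]].
set N := size P in Px *.
have ex : x ^+ N = \sum_(i < N) iota P`_i.+1 * x ^+ (N - i.+1).
  rewrite -[LHS]mulr1 -Px (horner_coef_wide (n := N.+1)); last first.
    by apply: leq_trans (size_poly _ _) _.
  rewrite big_ord_recl coef_map /= P0 rmorph0 mul0r add0r big_distrr /=.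
  apply: eq_bigr => i _; rewrite coef_map /bump /= add1n mulrCA.
  have -> : x ^+ N = x ^+ (N - i.+1) * x ^+ i.+1 by rewrite -exprD subnK.
  by rewrite exprVn mulfK // expf_neq0.
have N_gt0 : (0 < N)%N.
  rewrite lt0n size_poly_eq0; apply/eqP => P00.
  by move/eqP: Px; rewrite P00 rmorph0 horner0 eq_sym oner_eq0.
have intx : integralOver iota x.
  exists ('X^N - \poly_(j < N) P`_(N - j)).
    rewrite monicE lead_coefDl ?lead_coefXn // size_polyN size_polyXn ltnS.
    exact: size_poly.
  rewrite /root rmorphB /= map_polyXn hornerD hornerN hornerXn subr_eq0; apply/eqP.
  rewrite (horner_coef_wide (n := N)); last first.
    by apply: leq_trans (size_poly _ _) (size_poly _ _).
  rewrite ex [RHS](reindex_inj rev_ord_inj) /=; apply: eq_bigr => i _.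
  by rewrite coef_map coef_poly ltn_subrL /= N_gt0 subKn.
have [r er] := integral_closed L_fractions m_char intx.
have er' : r ^+ N = \sum_(i < N) P`_i.+1 * r ^+ (N - i.+1).
  apply: (proj1 L_fractions); rewrite rmorphXn -er ex rmorph_sum.
  by apply: eq_bigr => i _; rewrite rmorphM rmorphXn er.
exists r => //.
suff: forall d, (d <= p)%N -> idealX max_ideal d r by apply.
elim=> [|d IH] dp //; apply: (reduced_cone N_gt0); first by apply/IH/ltnW.
rewrite er'; apply: ideal_sum => [|i _]; first exact: idealX_ideal.
have Pi : idealX max_ideal (p * i.+1) P`_i.+1 by rewrite -idealX_idealX.
have ri : idealX max_ideal (d * (N - i.+1)) (r ^+ (N - i.+1)).
  by rewrite -idealX_idealX; apply: idealX_exp; apply/IH/ltnW.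
apply: idealX_le (idealX_mul Pi ri).
have -> : (d * N = d * (N - i.+1) + d * i.+1)%N by rewrite -mulnDr subnK.
nia.
Qed.

End Completeness.

Lemma surface_normal_ideal : normal_ideal max_ideal.
Proof.
move=> p p_gt0 L iota fracL; apply/seteqP; split=> x.
  exact: max_idealX_complete.
move=> [r Mr <-] V [subV _] _; have [V1 _ _] := proj2 (is_subringP V) subV;
  rewrite -[iota r]mul1r.
by apply: lin_span_term => //; exists r.
Qed.

Lemma prod_binomials (T : Type) (s : seq T) (a b : T -> R) (x w : R) :
  max_ideal x -> max_ideal w -> exists u,
    idealX max_ideal (size s).-1 u /\
    \prod_(i <- s) (a i * x + b i * w) = (\prod_(i <- s) b i) * w ^+ size s + x * u.
Proof.
move=> Mx Mw; elim: s => [|i s [u [Mu eu]]].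
  by exists 0; rewrite !big_nil mulr0 addr0 mul1r.
have [J0 JD JM] := idealX_ideal max_ideal (size s).
have Mxu : idealX max_ideal (size s) (x * u).
  by case: (size s) Mu {eu J0 JD JM} => [|k] // Mu; apply: idealM_mul.
have Mwu : idealX max_ideal (size s) (w * u).
  by case: (size s) Mu {eu J0 JD JM Mxu} => [|k] // Mu; apply: idealM_mul.
exists (a i * ((\prod_(j <- s) b j) * w ^+ size s + x * u) + b i * (w * u));
  split=> /=.
  by apply: (JD); apply: (JM) => //; apply: (JD) => //; apply/JM/idealX_exp.
by rewrite !big_cons eu exprS; ring.
Qed.

(** Modulo [F0] all the [F i] are nonzero multiples of one variable [w], so the
    equation of the surface puts [w ^+ h] in the ideal of [F0] and [Z]; as
    [h < m], the cofactors have order at least [h - 1]. *)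
Lemma surface_reduction (F0 : A0) : linear_form F0 ->
  (forall i, coprime_elts F0 (F i)) -> forall p, (0 < p)%N ->
  reduction (ideal_gen [set loc (q (mwiden F0 ^+ p)); loc (q (Z ^+ p))])
    (idealX max_ideal p).
Proof.
move=> linF0 copF0 p p_gt0; have [j Hj] := plane_linear_form linF0.
pose x := theta (mwiden F0); pose y := theta Z; pose w := theta (mwiden 'X_j).
have Mlin (T : S) : linear_form T -> max_ideal (theta T).
  move=> [_ homT]; rewrite /max_ideal /= theta_unit negbK; apply/eqP.
  by apply: (dhomog_nemf_coeff homT); rewrite /= mdeg0.
have Mx : max_ideal x by apply/Mlin/linear_form_mwiden.
have My : max_ideal y by apply/Mlin/linear_formX.
have Mw : max_ideal w by apply/Mlin/linear_form_mwiden/linear_formX.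
have dec T : linear_form T -> exists a b : K,
    theta (mwiden T) = theta a%:MP * x + theta b%:MP * w /\ T = a *: F0 + b *: 'X_j.
  move=> /Hj [a [b eT]]; exists a, b; split=> //.
  by rewrite {1}eT mwidenD !mwidenZ -!mul_mpolyC rmorphD !rmorphM.
have genM r : max_ideal r -> exists a b c, r = a * x + b * y + c * w.
  pose I := [set r | exists a b c, r = a * x + b * y + c * w].
  have idI : is_ideal I.
    split.
    - by exists 0, 0, 0; rewrite !mul0r !addr0.
    - move=> _ _ [a [b [c ->]]] [a' [b' [c' ->]]].
      by exists (a + a'), (b + b'), (c + c'); ring.
    - by move=> t _ [a [b [c ->]]]; exists (t * a), (t * b), (t * c); ring.
  have [a [s [s0 ->]]] := theta_frac r => /(max_ideal_frac _ s0) a0.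
  apply: (ideal_mulr (I := I)) => //; apply: ideal_vars => // i.
  case: (unliftP ord_max i) => [k ->|->].
    have -> : lift ord_max k = widen_ord (leqnSn 2) k.
      by apply: ord_inj; rewrite lift_max.
    rewrite -mwidenXU; have [b [c [-> _]]] := dec _ (linear_formX K k).
    by exists (theta b%:MP), 0, (theta c%:MP); rewrite mul0r addr0.
  by exists 0, 1, 0; rewrite !mul0r mul1r add0r addr0.
have wk : exists u v, [/\ idealX max_ideal h.-1 u, idealX max_ideal h.-1 v &
    w ^+ h.-1.+1 = x * u + y * v].
  have /choice [a Ha] : forall i, exists a, exists b : K,
    theta (mwiden (F i)) = theta a%:MP * x + theta b%:MP * w /\ F i = a *: F0 +
      b *: 'X_j.
    by move=> i; apply: dec.
  have {Ha} /choice [b Hb] := Ha.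
  have b0 i : b i != 0.
    apply/eqP => bi0; have [_ e] := Hb i; rewrite bi0 scale0r addr0 in e.
    apply: (coprime_not_divides linF0 (copF0 i)).
    by exists (a i)%:MP; rewrite e -mul_mpolyC mulrC.
  have [u [Mu eu]] := prod_binomials (index_enum 'I_h)
    (fun i => theta (a i)%:MP) (fun i => theta (b i)%:MP) Mx Mw.
  have sz : size (index_enum 'I_h) = h by rewrite -[RHS]card_ord cardT enumT.
  rewrite sz in Mu eu.
  have ef : theta f = y ^+ m.
    apply/esym/eqP; rewrite -subr_eq0 -rmorphXn -rmorphB; apply/eqP/theta_eq0.
    by exists 1; rewrite mulr1.
  set beta := \prod_(i <- index_enum _) theta (b i)%:MP in eu.
  have ubeta : beta \is a GRing.unit.
    rewrite /beta -rmorph_prod theta_unit -rmorph_prod /ev0 mcoeffC eqxx mulr1.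
    by apply/prodf_neq0.
  have e : y ^+ m = beta * w ^+ h + x * u.
    by rewrite -ef -eu /f rmorph_prod; apply: eq_bigr => i _; case: (Hb i).
  have [_ _ JM] := idealX_ideal max_ideal h.-1.
  exists (- beta^-1 * u), (beta^-1 * y ^+ m.-1); split; try exact: (JM).
    by apply: (JM); apply: (@idealX_le _ _ h.-1 m.-1); [lia|apply: idealX_exp].
  have -> : y * (beta^-1 * y ^+ m.-1) = beta^-1 * y ^+ m.
    by rewrite mulrCA -exprS prednK.
  by rewrite prednK // e mulrDr mulKr //; ring.
rewrite !rmorphXn; exact: (reduction_powers max_ideal_is_ideal Mx My Mw genM wk).
Qed.

End Surface.

Theorem mainTheorem1
    (K : fieldType) (m h : nat) (F : 'I_h -> {mpoly K[2]})
    (h_gt0 : (0 < h)%N) (h_lt_m : (h < m)%N)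
    (m_char : forall c : nat, c \in [pchar K] -> ~~ (c %| m)%N)
    (F_linear : forall i : 'I_h, linear_form (F i))
    (F_coprime : forall i j : 'I_h, i != j -> coprime_elts (F i) (F j))
    (* B = K[X,Y,Z]/(G), and R = localization of B at the ideal generated by
       the images of X, Y, Z *)
    (B : comNzRingType) (q : {rmorphism {mpoly K[3]} -> B})
    (B_quotient : is_quotient q (ideal_gen [set surface_poly m F]))
    (R : comUnitRingType) (loc : {rmorphism B -> R})
    (R_localization :
       is_localization_at loc (ideal_gen (range (fun i : 'I_3 => q 'X_i)))) :
  irreducible_elt (surface_poly m F) /\
  normal_domain R /\
  local_ring R /\
  (forall M : set R, maximal_ideal M ->
     normal_ideal M /\
     (forall F0 : {mpoly K[2]},
        linear_form F0 -> (forall i : 'I_h, coprime_elts F0 (F i)) ->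
        forall p : nat, (0 < p)%N ->
          reduction
            (ideal_gen [set loc (q (mwiden F0 ^+ p)); loc (q ('X_ord_max ^+ p))])
            (idealX M p))).
Proof.
split; first exact: surface_irreducible.
split; first exact: (surface_normal h_gt0 h_lt_m F_linear F_coprime B_quotient
  R_localization m_char).
split; first exact: (surface_local h_gt0 h_lt_m F_linear F_coprime B_quotient
  R_localization).
move=> M maxM.
have -> := maximal_unique h_gt0 h_lt_m F_linear F_coprime B_quotient
  R_localization maxM.
split.
  exact: (surface_normal_ideal h_gt0 h_lt_m F_linear F_coprime B_quotient
    R_localization m_char).
exact: (surface_reduction h_gt0 h_lt_m F_linear F_coprime B_quotient
  R_localization).
Qed.
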